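(* Let $(R,\mathfrak{m})$ be a commutative Noetherian local ring and let $x_1,\ldots,x_s$ be a filter regular sequence in $R$. For $i=1,\ldots,s$, let $$a_i = \ell\ell_R\left( \frac{(x_1,\ldots,x_{i-1}):x_i}{(x_1,\ldots,x_{i-1})}\right).$$ Set $N=\max\{ a_1 + 2a_2 + \cdots + 2^{s-1}a_s,\ \operatorname{ar}_{\mathfrak{m}}(x_1),\ldots,\operatorname{ar}_{\mathfrak{m}}(x_1,\ldots,x_s)\} + 1$. Let $x_i' = x_i + \varepsilon_i$, where $\varepsilon_i$ is an arbitrary element of $\mathfrak{m}^N$, $i=1,\ldots,s$. Then $$\sum_{i=1}^s (-1)^i\ell(H_i(R_{x_1',\ldots,x_s'})) = \sum_{i=1}^s (-1)^i\ell(H_i(R_{x_1,\ldots,x_s})).$$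
   Context: All rings are commutative, Noetherian, with identity. A sequence $x_1,\ldots,x_s$ in a local ring $(R,\mathfrak{m})$ is called filter regular if $\operatorname{Supp}\left(\frac{(x_1,\ldots,x_{i-1}):x_i}{(x_1,\ldots,x_{i-1})}\right)\subseteq\{\mathfrak{m}\}$ for all $i=1,\ldots,s$ (for $i=1$ the ideal $(x_1,\ldots,x_{i-1})$ is $0$). Equivalently, the image of each $x_i$ in $R/(x_1,\ldots,x_{i-1})$ avoids every associated prime of that ring other than the maximal ideal. For an $R$-module $M$, $\ell(M)$ denotes its length and $\ell\ell_R(M):=\inf\{n\ge 0 \mid \mathfrak{m}^nM=0\}$ is its Loewy length. For an ideal $I$ of $R$, the Artin-Rees number $\operatorname{ar}_{\mathfrak{m}}(I)$ is the smallest $c \geq 0$ such that $\mathfrak{m}^n\cap I=\mathfrak{m}^{n-c}(\mathfrak{m}^c\cap I)$ for all $n\ge c$; $\operatorname{ar}_{\mathfrak{m}}(x_1,\ldots,x_i)$ means $\operatorname{ar}_{\mathfrak{m}}$ of the ideal $(x_1,\ldots,x_i)$. $R_{x_1,\ldots,x_s}=R_{x_1}\otimes\cdots\otimes R_{x_s}$ denotes the Koszul complex of $x_1,\ldots,x_s$ over $R$, where $R_x$ is the complex $0\to R\xrightarrow{x}R\to 0$ in degrees $1$ and $0$; $H_i(R_{x_1,\ldots,x_s})$ is its $i$-th homology. For a filter regular sequence, these modules have finite length for $i=1,\ldots,s$. *)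

(* Defs.v *)
From HB Require Import structures.
From mathcomp Require Import all_boot all_order all_algebra.
From mathcomp Require Import ring boolp.

Set Warnings "-redundant-canonical-projection".
Set Implicit Arguments.
Unset Strict Implicit.
Unset Printing Implicit Defensive.

Import GRing.Theory.
Local Open Scope ring_scope.

(* An ideal is an R-submodule of R, possibly improper, unlike
   the library's [idealr].  Membership is boolean, through the classical `[< _ >]. *)
Notation ideal R := (submodClosed R^o).

(* The minimum of P, and the junk value 0 when P is empty. *)
Definition least (P : nat -> Prop) : nat :=
  if pselect (exists n, `[< P n >]) is left h then ex_minn h else 0%N.

Section Ideals.
Variable R : comNzRingType.
Implicit Types I J m p : ideal R.

Definition ideal_gen_pred (G : {pred R}) : {pred R^o} :=
  fun r => `[< forall I, {subset G <= I} -> r \in I >].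

Fact ideal_gen_closed G : submod_closed (ideal_gen_pred G).
Proof.
split=> [|a u v /asboolP uG /asboolP vG]; apply/asboolP => I GI.
  exact: rpred0.
by rewrite rpredD ?rpredZ ?uG ?vG.
Qed.
HB.instance Definition _ G :=
  GRing.isSubmodClosed.Build R R^o (ideal_gen_pred G) (ideal_gen_closed G).
Definition ideal_gen (G : {pred R}) : ideal R := ideal_gen_pred G.

Definition idealM I J : ideal R :=
  ideal_gen (fun r => `[< exists a b, [/\ a \in I, b \in J & r = a * b] >]).

Fixpoint idealX I n : ideal R :=
  if n is n'.+1 then idealM I (idealX I n') else ideal_gen predT.

Definition idealI_pred I J : {pred R^o} := [predI I & J].
Fact idealI_closed I J : submod_closed (idealI_pred I J).
Proof.
split=> [|a u v /andP[uI uJ] /andP[vI vJ]]; apply/andP; first by rewrite !rpred0.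
by split; rewrite rpredD ?rpredZ.
Qed.
HB.instance Definition _ I J :=
  GRing.isSubmodClosed.Build R R^o (idealI_pred I J) (idealI_closed I J).
Definition idealI I J : ideal R := idealI_pred I J.

Definition colon_pred I (x : R) : {pred R^o} := [pred r : R^o | (r * x : R^o) \in I].
Fact colon_closed I x : submod_closed (colon_pred I x).
Proof.
split=> [|a u v uI vI]; rewrite inE; first by rewrite mul0r rpred0.
by rewrite mulrDl -scalerAl rpredD // rpredZ.
Qed.
HB.instance Definition _ I x :=
  GRing.isSubmodClosed.Build R R^o (colon_pred I x) (colon_closed I x).
Definition colon I (x : R) : ideal R := colon_pred I x.

Definition is_proper I := (1 : R^o) \notin I.

Definition prime_ideal p := is_proper p /\ prime_idealr_closed (p : {pred R}).

Definition maximal_ideal m :=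
  is_proper m /\ forall I, is_proper I -> {subset m <= I} -> I =i m.

Definition local_ring m :=
  maximal_ideal m /\ forall n : ideal R, maximal_ideal n -> n =i m.

Definition noetherian :=
  forall I, exists xs : seq R, I =i ideal_gen (mem xs).

Definition artin_rees m I : nat :=
  least (fun c => forall n, (c <= n)%N ->
    idealI (idealX m n) I =i idealM (idealX m (n - c)) (idealI (idealX m c) I)).

End Ideals.

Section Submodule.
Variables (R : comNzRingType) (V : lmodType R).

Definition submod (A : submodClosed V) := {v : V | v \in A}.
HB.instance Definition _ A := SubChoice.on (submod A).
HB.instance Definition _ A := [SubChoice_isSubLmodule of submod A by <:].

End Submodule.

Section Quotient.
Variables (R : comNzRingType) (V : lmodType R) (A : submodClosed V).

(* The library quotients a zmodType by a zmodClosed predicate, which a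
   submodClosed one is not by inheritance; we add the R-action. *)
Definition zmod_pred : {pred V} := A.
Fact zmod_pred_closed : zmod_closed zmod_pred.
Proof. by split=> [|u v uA vA]; rewrite ?rpred0 // -scaleN1r rpredD // rpredZ. Qed.
HB.instance Definition _ := GRing.isZmodClosed.Build V zmod_pred zmod_pred_closed.

Definition quotmod := Quotient.quot zmod_pred.
HB.instance Definition _ := GRing.Zmodule.on quotmod.
HB.instance Definition _ := EqQuotient.on quotmod.

Definition quotmod_scale (a : R) (q : quotmod) : quotmod :=
  \pi_quotmod%qT (a *: repr q).

Lemma quotmod_eq (x y : V) :
  (\pi_quotmod%qT x == \pi_quotmod%qT y) = (x - y \in A).
Proof. by rewrite (Quotient.idealrBE zmod_pred). Qed.

Lemma quotmod_repr (x : V) : repr (\pi_quotmod%qT x) - x \in A.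
Proof. by rewrite -quotmod_eq reprK. Qed.

Lemma quotmod_scaleE a x : quotmod_scale a (\pi_quotmod%qT x) = \pi_quotmod%qT (a *: x).
Proof. by apply/eqP; rewrite quotmod_eq -scalerBr rpredZ ?quotmod_repr. Qed.

Lemma quotmodD x y :
  \pi_quotmod%qT (x + y) = \pi_quotmod%qT x + \pi_quotmod%qT y.
Proof. exact: (Quotient.pi_add zmod_pred). Qed.

Fact quotmod_scaleA a b q :
  quotmod_scale a (quotmod_scale b q) = quotmod_scale (a * b) q.
Proof.
elim/quotW: q => x.
by rewrite (quotmod_scaleE b) (quotmod_scaleE a) quotmod_scaleE scalerA.
Qed.
Fact quotmod_scale1 : left_id 1 quotmod_scale.
Proof. by elim/quotW=> x; rewrite quotmod_scaleE scale1r. Qed.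
Fact quotmod_scaleDr : right_distributive quotmod_scale +%R.
Proof.
move=> a; elim/quotW=> x; elim/quotW=> y.
by rewrite -quotmodD !quotmod_scaleE scalerDr quotmodD.
Qed.
Fact quotmod_scaleDl q : {morph quotmod_scale^~ q : a b / a + b}.
Proof.
by move=> a b /=; elim/quotW: q => x; rewrite !quotmod_scaleE scalerDl quotmodD.
Qed.
HB.instance Definition _ := GRing.Zmodule_isLmodule.Build R quotmod
  quotmod_scaleA quotmod_scale1 quotmod_scaleDr quotmod_scaleDl.
End Quotient.

Section Subquotient.
Variables (R : comNzRingType) (V : lmodType R).

Definition restrict_pred (A B : submodClosed V) : {pred submod A} :=
  [pred v | val v \in B].
Arguments restrict_pred : clear implicits.
Fact restrict_closed A B : submod_closed (restrict_pred A B).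
Proof.
split=> [|a u v uB vB]; rewrite inE; first by rewrite raddf0 rpred0.
have -> : val (a *: u + v) = a *: val u + val v 
  by rewrite raddfD; congr (_ + _); exact: linearZ_LR.
by rewrite rpredD // rpredZ.
Qed.
HB.instance Definition _ A B := GRing.isSubmodClosed.Build R (submod A)
  (restrict_pred A B) (restrict_closed A B).

(* A / B, or A / (A :&: B) when B is not contained in A. *)
Definition subquot (A B : submodClosed V) : lmodType R :=
  quotmod (restrict_pred A B).
End Subquotient.

Section Modules.
Variables (R : comNzRingType) (M : lmodType R).

Definition loewy_length (m : ideal R) : nat :=
  least (fun n => forall (a : R^o) (v : M), a \in idealX m n -> (a : R) *: v = 0).

(* Equality of the fractions f.1 / f.2 and g.1 / g.2 in the localization of M
   at p. *)
Definition frac_eq (p : ideal R) (f g : M * R) :=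
  exists2 u : R, (u : R^o) \notin p & u *: (g.2 *: f.1 - f.2 *: g.1) = 0.

(* p belongs to Supp M: the localization of M at p is nonzero. *)
Definition in_support (p : ideal R) :=
  prime_ideal p /\
  exists2 f : M * R, (f.2 : R^o) \notin p & ~ frac_eq p f (0, 1).

Definition strict_chain k (C : nat -> submodClosed M) :=
  forall i, (i < k)%N -> {subset C i <= C i.+1} /\ ~ {subset C i.+1 <= C i}.

Definition length_le n := forall k C, strict_chain k C -> (k <= n)%N.
Definition finite_length := exists n, length_le n.

(* The supremum of the lengths of chains of submodules (0 if unbounded). *)
Definition module_length : nat := least length_le.
End Modules.

Section FilterRegular.
Variables (R : comNzRingType) (m : ideal R).

(* ((x_1, ..., x_i) : x_{i+1}) / (x_1, ..., x_i), the entries of xs being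
   numbered from 1. *)
Definition colon_quot (xs : seq R) (i : nat) : lmodType R :=
  let I := ideal_gen (mem (take i xs)) in subquot (colon I xs`_i) I.

Definition filter_regular (xs : seq R) :=
  forall i, (i < size xs)%N ->
  forall p : ideal R, in_support (colon_quot xs i) p -> p =i m.
End FilterRegular.

(* Bounded complexes of finite free modules with a homogeneous basis; the
   differential is d e_a = \sum_b coef a b e_b. *)
Record free_complex (R : comNzRingType) := FreeComplex {
  basis :> finType;
  deg : basis -> nat;
  coef : basis -> basis -> R;
  coef_deg : forall a b, coef a b != 0 -> deg a = (deg b).+1;
  coef_sq : forall a c, \sum_b coef a b * coef b c = 0
}.

Section Complexes.
Variable R : comNzRingType.
Implicit Types C D : free_complex R.

Definition chains C : lmodType R := {ffun C -> R^o}.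

Definition homog C n (v : chains C) := forall b, deg b != n -> v b = 0.

Definition diff C (v : chains C) : chains C :=
  [ffun b => \sum_a v a * coef a b].

Fact diff_linear C : linear (@diff C).
Proof.
move=> a u v; apply/ffunP => b; rewrite !ffunE scaler_sumr -big_split.
by apply: eq_bigr => c _; rewrite !ffunE mulrDl -scalerAl.
Qed.
HB.instance Definition _ C :=
  GRing.isLinear.Build R (chains C) (chains C) _ (@diff C) (@diff_linear C).

Fact homog_closed C n a (u v : chains C) :
  homog n u -> homog n v -> homog n (a *: u + v).
Proof. by move=> hu hv b nb; rewrite !ffunE hu ?hv // scaler0 addr0. Qed.

Definition cycles_pred C n : {pred chains C} :=
  fun v => `[< homog n v /\ diff v = 0 >].
Arguments cycles_pred : clear implicits.
Fact cycles_closed C n : submod_closed (cycles_pred C n).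
Proof.
split=> [|a u v /asboolP[hu du] /asboolP[hv dv]]; apply/asboolP; split.
- by move=> b _; rewrite ffunE.
- exact: linear0.
- exact: homog_closed.
- by rewrite diff_linear du dv scaler0 addr0.
Qed.
HB.instance Definition _ C n := GRing.isSubmodClosed.Build R (chains C)
  (cycles_pred C n) (cycles_closed C n).

Definition boundaries_pred C n : {pred chains C} :=
  fun v => `[< exists2 w, homog n.+1 w & v = diff w >].
Arguments boundaries_pred : clear implicits.
Fact boundaries_closed C n : submod_closed (boundaries_pred C n).
Proof.
split=> [|a _ _ /asboolP[u hu ->] /asboolP[v hv ->]]; apply/asboolP.
  by exists 0; [move=> b _; rewrite ffunE | rewrite linear0].
by exists (a *: u + v); [exact: homog_closed | rewrite diff_linear].
Qed.
HB.instance Definition _ C n := GRing.isSubmodClosed.Build R (chains C)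
  (boundaries_pred C n) (boundaries_closed C n).

Definition homology C n : lmodType R :=
  subquot (cycles_pred C n) (boundaries_pred C n).

(* d (a (x) b) = d a (x) b + (-1)^(deg a) a (x) d b *)
Section Tensor.
Variables C D : free_complex R.

Definition tensor_deg (a : C * D) : nat := (deg a.1 + deg a.2)%N.
Definition tensor_coef (a b : C * D) : R :=
  coef a.1 b.1 * (a.2 == b.2)%:R
  + (-1) ^+ deg a.1 * (a.1 == b.1)%:R * coef a.2 b.2.

Fact tensor_coef_deg a b :
  tensor_coef a b != 0 -> tensor_deg a = (tensor_deg b).+1.
Proof.
case: a b => [a a'] [b b']; rewrite /tensor_coef /tensor_deg /= => ne0.
have [ab|ab] := eqVneq (coef a b * (a' == b')%:R) 0.
  move: ne0; rewrite ab add0r; have [-> ne0|_] := eqVneq a b; last first.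
    by rewrite mulr0 mul0r eqxx.
  rewrite (@coef_deg _ _ a' b') ?addnS //; by apply: contraNneq ne0 => ->; rewrite mulr0.
have -> : a' = b' by apply/eqP; apply: contraNT ab => /negPf ->; rewrite mulr0.
by rewrite (@coef_deg _ _ a b) //; apply: contraNneq ab => ->; rewrite mul0r.
Qed.

Fact tensor_coef_sq a c : \sum_b tensor_coef a b * tensor_coef b c = 0.
Proof.
case: a c => [a a'] [c c']; rewrite /tensor_coef /=.
rewrite -(pair_bigA _ (fun b b' =>
  (coef a b * (a' == b')%:R + (-1) ^+ deg a * (a == b)%:R * coef a' b') *
  (coef b c * (b' == c')%:R + (-1) ^+ deg b * (b == c)%:R * coef b' c'))) /=.
have delta (T : finType) (t : T) (F : T -> R) : \sum_b (t == b)%:R * F b = F t.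
  rewrite (bigD1 t) //= eqxx mul1r big1 ?addr0 // => b /negPf.
  by rewrite eq_sym => ->; rewrite mul0r.
have delta' (T : finType) (t : T) (F : T -> R) : \sum_b F b * (b == t)%:R = F t.
  by rewrite -[RHS](delta _ t); apply: eq_bigr => b _; rewrite eq_sym mulrC.
transitivity (\sum_b (coef a b * coef b c * (a' == c')%:R
    + coef a b * (-1) ^+ deg b * (b == c)%:R * coef a' c'
    + (a == b)%:R * ((-1) ^+ deg a * coef b c * coef a' c'))).
  apply: eq_bigr => b _.
  transitivity (\sum_b' ((a' == b')%:R * (coef a b * (coef b c * (b' == c')%:R
       + (-1) ^+ deg b * (b == c)%:R * coef b' c'))
     + (-1) ^+ deg a * (a == b)%:R * coef b c * coef a' b' * (b' == c')%:R
     + (-1) ^+ deg a * (a == b)%:R * ((-1) ^+ deg b * (b == c)%:R)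
       * (coef a' b' * coef b' c'))).
    by apply: eq_bigr => b' _; ring.
  rewrite !big_split /= delta delta' -big_distrr /= coef_sq; ring.
rewrite !big_split /= delta -!big_distrl /= coef_sq delta'.
have [->|/coef_deg ->] := eqVneq (coef a c) 0; first by ring.
by rewrite exprS; ring.
Qed.

Definition tensor : free_complex R :=
  FreeComplex tensor_coef_deg tensor_coef_sq.
End Tensor.

(* R in degree 0, the unit of the tensor product. *)
Fact unit_coef_deg (a b : unit) : (0 : R) != 0 -> 0%N = 1%N.
Proof. by rewrite eqxx. Qed.
Fact unit_coef_sq (a c : unit) : \sum_(b : unit) (0 : R) * 0 = 0.
Proof. by rewrite big1 // => b _; rewrite mul0r. Qed.
Definition unit_complex : free_complex R :=
  @FreeComplex R unit (fun=> 0%N) (fun _ _ => 0) unit_coef_deg unit_coef_sq.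

(* 0 -> R -> R -> 0, with basis vectors true in degree 1 and false in degree 0
   and d e_true = x e_false. *)
Definition koszul1_coef (x : R) (a b : bool) : R := if a && ~~ b then x else 0.
Fact koszul1_coef_deg x a b :
  koszul1_coef x a b != 0 -> nat_of_bool a = (nat_of_bool b).+1.
Proof. by case: a b => [] []; rewrite /koszul1_coef ?eqxx. Qed.
Fact koszul1_coef_sq x a c : \sum_b koszul1_coef x a b * koszul1_coef x b c = 0.
Proof.
by rewrite big1 // => -[] _; rewrite /koszul1_coef ?andbF ?mul0r ?mulr0.
Qed.
Definition koszul1 (x : R) : free_complex R :=
  FreeComplex (@koszul1_coef_deg x) (koszul1_coef_sq x).

Definition koszul (xs : seq R) : free_complex R :=
  foldl (fun C x => tensor C (koszul1 x)) unit_complex xs.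

End Complexes.

(* Main.v *)
From HB Require Import structures.
Require Import Defs.
From mathcomp Require Import all_boot all_order all_algebra.
From mathcomp Require Import boolp ring zify.

(** Write [I_j] for the ideal [(x_1, ..., x_j)].  Tensoring a complex [C] with
    [0 -> R -x-> R -> 0] turns [H_n(C)] into two contributions: its cokernel under
    [x], to the homology in degree [n], and its kernel under [x], to the homology in
    degree [n + 1].  When [H_n(C)] has finite length these two have the same length
    and cancel in the alternating sum.  For the Koszul complex only the kernel of
    [x_s] on [H_0 = R / I_(s-1)] is left ([koszul_euler]):
<<
      sum_(i >= 1) (-1)^i l(H_i(x_1, ..., x_s)) = - l((I_(s-1) : x_s) / I_(s-1)).
>>
    So it is enough that perturbing the sequence preserves the lengths of the colon
    quotients [(I_(i-1) : x_i) / I_(i-1)] and keeps them killed by a power of [m]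
    ([perturb_colons]).

    The elements are perturbed one at a time, from the first to the last, each
    perturbed element joining the ideal modulo which the rest of the argument takes
    place.  Suppose that [f] becomes [f'] modulo an ideal [Y].  If a power of [m] that
    contains [f' - f] sends [Y : f] into [Y], and if the Artin-Rees number of [(Y,f)]
    is small, then [Y : f = Y : f'] ([colon_perturb]).  For the next elements [z] of
    the sequence one needs to compare [((Y,f) : z) / (Y,f)] with its perturbation.  It
    is an extension of [((Y,z) : f) / ((Y : f) + (z))] by the quotient of [Y : z] by its
    intersection with [(Y,f)] ([len_colon_split]).  Neither piece changes:
    the former because [colon_perturb] applies modulo [Y] and modulo [(Y,z)], the latter
    by Nakayama's lemma.  Hence the length is the same.  If [m ^ a] kills the original
    quotient it kills both pieces, so that [m ^ (2 a)] kills the perturbed one.  This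
    doubling, once for each of the elements [x_1, ..., x_(i-1)], is where the
    coefficient [2 ^ (i-1)] of [a_i] in the bound comes from.  The Artin-Rees condition
    is itself preserved by the perturbation ([ar_lt_perturb]).

    The rest makes the hypotheses available: Artin-Rees numbers exist because Rees
    algebras are Noetherian ([artin_rees_exists]), by Hilbert's basis theorem, and a
    finitely generated module supported at [m] is killed by a power of [m]
    ([support_kills]), hence has finite length ([fin_len_kills]). *)

Set Implicit Arguments.
Unset Strict Implicit.
Unset Printing Implicit Defensive.

Import GRing.Theory.
Local Open Scope ring_scope.

(** * Submodules *)

Lemma least_spec (P : nat -> Prop) n :
  P n -> P (least P) /\ forall k, P k -> (least P <= k)%N.
Proof.
move=> Pn; rewrite /least; case: pselect => [h|[]]; last by exists n; apply/asboolP.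
case: ex_minnP => k /asboolP Pk kmin; split=> // j /asboolP Pj; exact: kmin.
Qed.

Section Submodules.
Variables (R : comNzRingType) (V : lmodType R).
Implicit Types A B C : submodClosed V.

Lemma submod_ext A B : A =i B -> A = B.
Proof.
case: A B => [A [[cA] [sA]]] [B [[cB] [sB]]] eAB.
have {}eAB : A = B by apply/funext => v; exact: eAB.
case: B / eAB cB sB => cB sB.
by rewrite (Prop_irrelevance cA cB) (Prop_irrelevance sA sB).
Qed.

Lemma submod_anti A B : {subset A <= B} -> {subset B <= A} -> A = B.
Proof. by move=> sAB sBA; apply: submod_ext => v; apply/idP/idP => [/sAB|/sBA]. Qed.

Lemma rpredN_sub A v : v \in A -> - v \in A.
Proof. by move=> vA; rewrite -scaleN1r rpredZ. Qed.

Lemma rpredB_sub A u v : u \in A -> v \in A -> u - v \in A.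
Proof. by move=> uA vA; rewrite rpredD // rpredN_sub. Qed.

Lemma rpredBr_sub A u v : u - v \in A -> u \in A -> v \in A.
Proof. by move=> duv uA; rewrite -[v](subKr u) rpredB_sub. Qed.

Lemma rpredBl_sub A u v : u - v \in A -> v \in A -> u \in A.
Proof. by move=> duv vA; rewrite -[u](subrK v) rpredD. Qed.

Section OfProp.
Variables (P : V -> Prop) (P0 : P 0).
Hypothesis PZD : forall a u v, P u -> P v -> P (a *: u + v).

Definition submod_of_pred (_ : P 0)
    (_ : forall a u v, P u -> P v -> P (a *: u + v)) : {pred V} :=
  fun v => `[< P v >].
Fact submod_of_closed : submod_closed (submod_of_pred P0 PZD).
Proof.
split=> [|a u v /asboolP Pu /asboolP Pv]; apply/asboolP; first exact: P0.
exact: PZD.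
Qed.
HB.instance Definition _ :=
  GRing.isSubmodClosed.Build R V (submod_of_pred P0 PZD) submod_of_closed.
Definition submod_of : submodClosed V := submod_of_pred P0 PZD.

Lemma submod_ofP v : reflect (P v) (v \in submod_of).
Proof. exact: asboolP. Qed.
End OfProp.

Fact sub0_0 : (0 : V) = 0. Proof. by []. Qed.
Fact sub0_ZD (a : R) (u v : V) : u = 0 -> v = 0 -> a *: u + v = 0.
Proof. by move=> -> ->; rewrite scaler0 addr0. Qed.
Definition sub0 := submod_of sub0_0 sub0_ZD.

Definition subT : submodClosed V :=
  @submod_of (fun=> True) I (fun _ _ _ _ _ => I).

Lemma mem_subT v : v \in subT.
Proof. exact/asboolP. Qed.

Lemma sub0P v : reflect (v = 0) (v \in sub0).
Proof. exact: submod_ofP. Qed.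

Fact subI_0 A B : 0 \in A /\ 0 \in B. Proof. by rewrite !rpred0. Qed.
Fact subI_ZD A B a u v :
  u \in A /\ u \in B -> v \in A /\ v \in B -> a *: u + v \in A /\ a *: u + v \in B.
Proof. by case=> uA uB [vA vB]; rewrite !rpredD ?rpredZ. Qed.
Definition subI A B := submod_of (subI_0 A B) (@subI_ZD A B).

Fact subD_0 A B : exists2 a, a \in A & 0 - a \in B.
Proof. by exists 0; rewrite ?subr0 rpred0. Qed.
Fact subD_ZD A B r u v : (exists2 a, a \in A & u - a \in B) ->
  (exists2 a, a \in A & v - a \in B) -> exists2 a, a \in A & r *: u + v - a \in B.
Proof.
move=> [a aA aB] [b bA bB]; exists (r *: a + b); first by rewrite rpredD ?rpredZ.
have -> : r *: u + v - (r *: a + b) = r *: (u - a) + (v - b).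
  by rewrite scalerBr opprD addrACA.
by rewrite rpredD ?rpredZ.
Qed.
Definition subD A B := submod_of (subD_0 A B) (@subD_ZD A B).

Fact adj_0 B u : exists a : R, 0 - a *: u \in B.
Proof. by exists 0; rewrite scale0r subr0 rpred0. Qed.
Fact adj_ZD B u (r : R) v w : (exists a : R, v - a *: u \in B) ->
  (exists a : R, w - a *: u \in B) -> exists a : R, r *: v + w - a *: u \in B.
Proof.
move=> [a aB] [b bB]; exists (r * a + b).
have -> : r *: v + w - (r * a + b) *: u = r *: (v - a *: u) + (w - b *: u).
  by rewrite scalerBr scalerDl scalerA opprD addrACA.
by rewrite rpredD ?rpredZ.
Qed.
(** [B + R u] *)
Definition adj B u := submod_of (adj_0 B u) (@adj_ZD B u).

Lemma subIP A B v : reflect (v \in A /\ v \in B) (v \in subI A B).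
Proof. exact: submod_ofP. Qed.

Lemma subDP A B v : reflect (exists2 a, a \in A & v - a \in B) (v \in subD A B).
Proof. exact: submod_ofP. Qed.

Lemma adjP B u v : reflect (exists a, v - a *: u \in B) (v \in adj B u).
Proof. exact: submod_ofP. Qed.

Lemma subDl A B : {subset A <= subD A B}.
Proof. by move=> v vA; apply/subDP; exists v; rewrite // subrr rpred0. Qed.

Lemma subDr A B : {subset B <= subD A B}.
Proof. by move=> v vB; apply/subDP; exists 0; rewrite ?rpred0 // subr0. Qed.

Lemma subD_le A B C : {subset A <= C} -> {subset B <= C} -> {subset subD A B <= C}.
Proof. by move=> sA sB v /subDP[a /sA aC /sB]; rewrite -{2}[v](subrK a) => /rpredD->. Qed.

Lemma adj_sub B u : {subset B <= adj B u}.
Proof. by move=> v vB; apply/adjP; exists 0; rewrite scale0r subr0. Qed.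

Lemma adj_mem B u : u \in adj B u.
Proof. by apply/adjP; exists 1; rewrite scale1r subrr rpred0. Qed.

Lemma adj_le A B u : {subset B <= A} -> u \in A -> {subset adj B u <= A}.
Proof.
by move=> sBA uA v /adjP[a /sBA]; rewrite -{2}[v](subrK (a *: u)) => vA; rewrite rpredD ?rpredZ.
Qed.

Lemma adjC B u v : adj (adj B u) v = adj (adj B v) u.
Proof.
have le u1 v1 : {subset adj (adj B u1) v1 <= adj (adj B v1) u1}.
  apply: adj_le; last by apply: adj_sub; exact: adj_mem.
  by apply: adj_le; [move=> w wB; do 2!apply: adj_sub | exact: adj_mem].
by apply: submod_anti; apply: le.
Qed.

End Submodules.

(** * Length of an interval of submodules *)

Section Length.
Variables (R : comNzRingType) (V : lmodType R).
Implicit Types A B N : submodClosed V.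

Definition chain_between B A k (C : nat -> submodClosed V) :=
  strict_chain k C /\
  forall i, (i <= k)%N -> {subset B <= C i} /\ {subset C i <= A}.

Definition len_le B A n := forall k C, chain_between B A k C -> (k <= n)%N.
Definition fin_len B A := exists n, len_le B A n.

(** For [B] contained in [A] this is the length of [A / B].  Working with intervals
    of submodules of one ambient module avoids iterated quotients. *)
Definition len B A := least (len_le B A).

Lemma len_leP B A : fin_len B A ->
  len_le B A (len B A) /\ forall n, len_le B A n -> (len B A <= n)%N.
Proof. by case=> n /least_spec. Qed.

Lemma len_attained B A : {subset B <= A} -> fin_len B A ->
  exists C, chain_between B A (len B A) C.
Proof.
move=> sBA /len_leP[le_len min_len]; apply: contrapT => noC.
have noC' k C : chain_between B A k C -> (k < len B A)%N.
  move=> ch; rewrite ltn_neqAle (le_len _ _ ch) andbT.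
  by apply/eqP => k_len; apply: noC; exists C; rewrite -k_len.
have : (0 < len B A)%N by apply: (noC' 0%N (fun=> B)); split=> // i _; split=> // v.
case E: (len B A) => [//|l] _.
suff /min_len : len_le B A l by rewrite E ltnn.
by move=> k C /noC'; rewrite E.
Qed.

Lemma chain_concat B N A p q C D :
  chain_between B N p C -> chain_between N A q D -> {subset B <= N} -> {subset N <= A} ->
  chain_between B A (p + q) (fun i => if (i < p)%N then C i else D (i - p)%N).
Proof.
move=> [sC bC] [sD bD] sBN sNA; split=> i lei; last first.
  case: ltnP => lip.
    by case: (bC i (ltnW lip)) => h1 h2; split=> // v /h2 /sNA.
  case: (bD (i - p)%N); first by lia.
  by move=> h1 h2; split=> // v /sBN /h1.
case: (ltnP i p) => lip; last first.
  by rewrite ltnNge (leqW lip) /= subSn //; apply: sD; lia.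
have [s1 s2] := sC i lip; case: (ltnP i.+1 p) => // lpi.
have -> : (i.+1 - p)%N = 0%N by lia.
have [_ CN] := bC i.+1 lip; have [ND _] := bD 0%N (leq0n _).
split=> [v /s1 /CN /ND //|h]; apply: s2 => v /CN /ND; exact: h.
Qed.

(** Omitting the repetitions from a weakly increasing chain leaves a strict one. *)
Lemma weak_chain_steps B A n k (D : nat -> submodClosed V) : len_le B A n ->
  (forall i, (i < k)%N -> {subset D i <= D i.+1}) ->
  (forall i, (i <= k)%N -> {subset B <= D i} /\ {subset D i <= A}) ->
  (\sum_(i < k) ~~ `[< {subset D i.+1 <= D i} >] <= n)%N.
Proof.
move=> len_n incD bD.
suff [C [ch _]] : exists C,
    chain_between B A (\sum_(i < k) ~~ `[< {subset D i.+1 <= D i} >])%N C /\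
    C (\sum_(i < k) ~~ `[< {subset D i.+1 <= D i} >])%N = D k.
  exact: len_n ch.
elim: k incD bD => [|k IH] incD bD.
  by exists D; rewrite big_ord0; split=> //; split=> // i; rewrite leqn0 => /eqP ->; exact: bD.
rewrite big_ord_recr /=; set c := (X in (X + _)%N) in IH *.
have [||C [[sC bC] Cc]] := IH.
- by move=> i lti; apply: incD; exact: ltnW.
- by move=> i lei; apply: bD; exact: leqW.
case: asboolP => [sD|nsD] /=.
  exists C; rewrite addn0; split=> //; rewrite Cc.
  by apply: submod_anti => //; exact: incD.
exists (fun i => if (i <= c)%N then C i else D k.+1); rewrite addn1 ltnn; split=> //.
split=> i lei; last first.
  by case: leqP => hi; [exact: bC | exact: bD].
rewrite -ltnS lei; case: (ltnP i c) => hi; first exact: sC.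
have -> : i = c by lia.
by rewrite Cc; split=> //; exact: incD.
Qed.

(** Each proper step of a chain stays proper in its trace on [N] or in its image
    modulo [N]. *)
Lemma len_le_trans B N A p q : {subset B <= N} -> {subset N <= A} ->
  len_le B N p -> len_le N A q -> len_le B A (p + q).
Proof.
move=> sBN sNA hp hq k C [sC bC].
have h1 : (\sum_(i < k) ~~ `[< {subset subI (C i.+1) N <= subI (C i) N} >] <= p)%N.
  apply: (weak_chain_steps (D := fun i => subI (C i) N) hp) => i lei.
    by move=> v /subIP[vC vN]; apply/subIP; split=> //; apply: (proj1 (sC i lei)).
  split=> v; last by case/subIP.
  by move=> vB; apply/subIP; split; [apply: (proj1 (bC i lei)) | apply: sBN].
have h2 : (\sum_(i < k) ~~ `[< {subset subD (C i.+1) N <= subD (C i) N} >] <= q)%N.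
  apply: (weak_chain_steps (D := fun i => subD (C i) N) hq) => i lei.
    by apply: subD_le; [move=> v /(proj1 (sC i lei)) vC; apply: subDl | exact: subDr].
  by split; [exact: subDr | apply: subD_le => // v /(proj2 (bC i lei))].
apply: (leq_trans _ (leq_add h1 h2)); rewrite -big_split /= -[leqLHS]card_ord -sum1_card.
apply: leq_sum => i _; have [s1 s2] := sC i (ltn_ord i).
case: asboolP => [sI|_] //=; case: asboolP => [sD|_] //=.
case: s2 => v vC; have /sD/subDP[a aC vaN] : v \in subD (C i.+1) N by apply: subDl.
have /sI/subIP[vaC _] : v - a \in subI (C i.+1) N.
  by apply/subIP; split=> //; apply: rpredB_sub => //; exact: s1.
by rewrite -[v](subrK a) rpredD.
Qed.

Lemma len_le_sub B A B' A' n : {subset B <= B'} -> {subset A' <= A} ->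
  len_le B A n -> len_le B' A' n.
Proof.
move=> sB sA hn k C [sC bC]; apply: (hn k C); split=> // i /bC[h1 h2].
by split=> v; [move/sB/h1 | move/h2/sA].
Qed.

Lemma fin_len_sub B A B' A' : {subset B <= B'} -> {subset A' <= A} ->
  fin_len B A -> fin_len B' A'.
Proof. by move=> sB sA [n hn]; exists n; exact: len_le_sub hn. Qed.

Lemma fin_len_trans B N A : {subset B <= N} -> {subset N <= A} ->
  fin_len B N -> fin_len N A -> fin_len B A.
Proof. by move=> sBN sNA [p hp] [q hq]; exists (p + q)%N; exact: len_le_trans hq. Qed.

Lemma len_add B N A : {subset B <= N} -> {subset N <= A} -> fin_len B A ->
  len B A = (len B N + len N A)%N.
Proof.
move=> sBN sNA fBA; have fBN : fin_len B N by apply: fin_len_sub fBA.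
have fNA : fin_len N A by apply: fin_len_sub fBA.
have [le1 min1] := len_leP fBA.
apply/eqP; rewrite eqn_leq; apply/andP; split.
  by apply: min1; apply: len_le_trans sBN sNA _ _; apply: (proj1 (len_leP _)).
have [C hC] := len_attained sBN fBN; have [D hD] := len_attained sNA fNA.
exact: le1 (chain_concat hC hD sBN sNA).
Qed.

Lemma len_le_refl A : len_le A A 0.
Proof.
move=> [|k] C [sC bC] //; have [_ []] := sC 0%N isT.
have [_ h] := bC 1%N isT; have [h' _] := bC 0%N isT.
by move=> v /h /h'.
Qed.

Lemma fin_len_refl A : fin_len A A.
Proof. by exists 0%N; exact: len_le_refl. Qed.

Lemma len_refl A : len A A = 0%N.
Proof.
by apply/eqP; rewrite -leqn0; apply: (proj2 (len_leP (fin_len_refl A))); exact: len_le_refl.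
Qed.

End Length.

(** A linear relation that matches [A / B] with [A' / B'] transports submodules
    back and forth.  Relations, unlike maps, also cover the isomorphisms that
    have no preferred direction or that are only defined modulo a submodule. *)
Section Correspondence.
Variables (R : comNzRingType).

Definition linear_rel (V W : lmodType R) (rho : V -> W -> Prop) :=
  rho 0 0 /\ forall a u v u' v', rho u u' -> rho v v' -> rho (a *: u + v) (a *: u' + v').

Definition matches (V W : lmodType R) (rho : V -> W -> Prop)
    (B A : submodClosed V) (B' A' : submodClosed W) :=
  [/\ forall v, v \in A -> exists2 w, w \in A' & rho v w,
      forall w, w \in A' -> exists2 v, v \in A & rho v w &
      forall v w, v \in A -> w \in A' -> rho v w -> (v \in B) = (w \in B')].

Lemma linear_rel_flip (V W : lmodType R) (rho : V -> W -> Prop) :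
  linear_rel rho -> linear_rel (fun w v => rho v w).
Proof. by case=> r0 rD; split=> // a u v u' v'; exact: rD. Qed.

Lemma matches_flip (V W : lmodType R) (rho : V -> W -> Prop)
    (B A : submodClosed V) (B' A' : submodClosed W) :
  matches rho B A B' A' -> matches (fun w v => rho v w) B' A' B A.
Proof. by case=> h1 h2 h3; split=> // v w vA wA' r; rewrite (h3 w v). Qed.

Lemma len_le_matches (V W : lmodType R) (rho : V -> W -> Prop)
    (B A : submodClosed V) (B' A' : submodClosed W) n :
  linear_rel rho -> {subset B <= A} -> {subset B' <= A'} -> matches rho B A B' A' ->
  len_le B' A' n -> len_le B A n.
Proof.
move=> [r0 rD] sBA sBA' [h1 h2 h3] hn k C [sC bC].
pose P i w := w \in A' /\ exists2 v, v \in C i & rho v w.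
have P0 i : P i 0 by split; [exact: rpred0 | exists 0; rewrite ?rpred0].
have PZD i a u v : P i u -> P i v -> P i (a *: u + v).
  move=> [uA [u0 u0C ru]] [vA [v0 v0C rv]]; split; first by rewrite rpredD ?rpredZ.
  by exists (a *: u0 + v0); [rewrite rpredD ?rpredZ | exact: rD].
pose D i := submod_of (P0 i) (@PZD i).
apply: (hn k D); split=> i lei.
  have [s1 s2] := sC i lei; split=> [w /submod_ofP[wA [v vC r]]|sD].
    by apply/submod_ofP; split=> //; exists v => //; exact: s1.
  apply: s2 => v vC; have vA : v \in A by apply: (proj2 (bC i.+1 lei)).
  have [w wA r] := h1 v vA.
  have /sD/submod_ofP[_ [u uC ru]] : w \in D i.+1 by apply/submod_ofP; split=> //; exists v.
  have uA : u \in A by apply: (proj2 (bC i (ltnW lei))).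
  have dB : v - u \in B.
    rewrite (h3 _ 0) ?rpred0 ?rpredB_sub //.
    have := rD (-1) _ _ _ _ ru r; rewrite !scaleN1r addNr addrC; exact.
  by rewrite -[v](subrK u) rpredD // (proj1 (bC i (ltnW lei))).
have [bB bA] := bC i lei; split=> w; last by case/submod_ofP.
move=> wB; have wA := sBA' _ wB; apply/submod_ofP; split=> //.
by have [v vA r] := h2 w wA; exists v => //; apply: bB; rewrite (h3 v w).
Qed.

Lemma least_ext (P Q : nat -> Prop) : (forall n, P n <-> Q n) -> least P = least Q.
Proof. by move=> PQ; congr least; apply/funext => n; apply/propext. Qed.

Lemma len_matches (V W : lmodType R) (rho : V -> W -> Prop)
    (B A : submodClosed V) (B' A' : submodClosed W) :
  linear_rel rho -> {subset B <= A} -> {subset B' <= A'} -> matches rho B A B' A' ->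
  (fin_len B A <-> fin_len B' A') /\ len B A = len B' A'.
Proof.
move=> lr sBA sBA' mt.
have h n : len_le B A n <-> len_le B' A' n.
  split; last exact: len_le_matches mt.
  exact: len_le_matches (linear_rel_flip lr) _ _ (matches_flip mt).
by split; [split=> -[n /h hn]; exists n | exact: least_ext].
Qed.

End Correspondence.

Section LengthApplications.
Variables (R : comNzRingType) (V : lmodType R).
Implicit Types A B : submodClosed V.

Lemma module_len (M : lmodType R) :
  (finite_length M <-> fin_len (sub0 M) (subT M)) /\
  module_length M = len (sub0 M) (subT M).
Proof.
have h n : @length_le R M n <-> len_le (sub0 M) (subT M) n.
  split=> hn k C; first by case=> sC _; exact: hn sC.
  move=> sC; apply: (hn k C); split=> // i _; split=> v; last by move=> _; exact: mem_subT.
  by move/sub0P => ->; exact: rpred0.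
by split; [split=> -[n /h hn]; exists n | exact: least_ext].
Qed.

Lemma subquot_len A B : {subset B <= A} ->
  (finite_length (subquot A B) <-> fin_len B A) /\
  module_length (subquot A B) = len B A.
Proof.
move=> sBA.
pose rho (v : V) (q : subquot A B) :=
  exists2 u : submod A, val u = v & q = \pi_(quotmod (@restrict_pred R V A B))%qT u.
suff [f e] : (fin_len B A <-> fin_len (sub0 (subquot A B)) (subT (subquot A B))) /\
    len B A = len (sub0 (subquot A B)) (subT (subquot A B)).
  by have [f' e'] := module_len (subquot A B); rewrite f' e' e; split=> //; split=> /f.
apply: (len_matches (rho := rho)) => //.
- split; first by exists 0; rewrite ?raddf0.
  move=> a _ _ _ _ [u <- ->] [v <- ->]; exists (a *: u + v).
    by rewrite raddfD; congr (_ + _); exact: linearZ_LR.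
  by rewrite quotmodD -quotmod_scaleE.
- by move=> v _; exact: mem_subT.
split.
- move=> v vA; exists (\pi_(quotmod (@restrict_pred R V A B))%qT (exist _ v vA)).
    exact: mem_subT.
  by exists (exist _ v vA).
- move=> q _; elim/quotW: q => u; exists (val u); [exact: (proj2_sig u) | by exists u].
move=> v q vA _ [u <- ->]; have pi0 : \pi_(quotmod (@restrict_pred R V A B))%qT 0 = 0 :> subquot A B by rewrite raddf0.
apply/idP/sub0P => [uB|/eqP]; last by rewrite -pi0 quotmod_eq subr0.
by apply/eqP; rewrite -pi0 quotmod_eq subr0.
Qed.

End LengthApplications.

(** * Ideals of a Noetherian local ring *)

(* Ideals are predicates on the regular module, and ring elements are not
   syntactically elements of it. *)
Local Notation "r '\ini' I" := (@in_mem (GRing.regular _) r (mem I))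
  (at level 70, no associativity).

Section IdealOperations.
Variable R : comNzRingType.
Implicit Types (I J K Y : ideal R) (a b f r : R).

Lemma ideal0 I : 0 \ini I. Proof. exact: rpred0. Qed.

Lemma idealD I a b : a \ini I -> b \ini I -> a + b \ini I. Proof. exact: rpredD. Qed.

Lemma idealN I a : a \ini I -> - a \ini I. Proof. exact: rpredN_sub. Qed.

Lemma idealB I a b : a \ini I -> b \ini I -> a - b \ini I. Proof. exact: rpredB_sub. Qed.

Lemma ideal_mull I a b : b \ini I -> a * b \ini I.
Proof. exact: (@rpredZ R R^o I a b). Qed.

Lemma ideal_mulr I a b : a \ini I -> a * b \ini I.
Proof. by rewrite mulrC; exact: ideal_mull. Qed.

Lemma ideal_sum (T : Type) (s : seq T) I (F : T -> R) :
  (forall t, F t \ini I) -> \sum_(t <- s) F t \ini I.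
Proof. by move=> FI; elim/big_ind: _ => // *; [exact: ideal0 | exact: idealD]. Qed.

Lemma ideal_adjP Y f r : reflect (exists a, r - a * f \ini Y) (r \ini adj Y f).
Proof. exact: adjP. Qed.

Lemma ideal_sub_adj Y f r : r \ini Y -> r \ini adj Y f.
Proof. exact: adj_sub. Qed.

Lemma ideal_mul_adj Y f a : a * f \ini adj Y f.
Proof. by apply: ideal_mull; apply: adj_mem. Qed.

Lemma mem_colon Y f r : (r \ini colon Y f) = (r * f \ini Y).
Proof. by []. Qed.

Lemma ideal_genT r : r \ini ideal_gen predT.
Proof. by apply/asboolP => I; apply. Qed.

Lemma ideal_gen_mem (G : {pred R}) r : r \in G -> r \ini ideal_gen G.
Proof. by move=> Gr; apply/asboolP => I; apply. Qed.

Lemma ideal_gen_le (G : {pred R}) I :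
  (forall r, r \in G -> r \ini I) -> forall r, r \ini ideal_gen G -> r \ini I.
Proof. by move=> GI r /asboolP; apply. Qed.

Lemma idealM_mem I J a b : a \ini I -> b \ini J -> a * b \ini idealM I J.
Proof. by move=> aI bJ; apply: ideal_gen_mem; apply/asboolP; exists a, b. Qed.

Lemma idealM_le I J K : (forall a b, a \ini I -> b \ini J -> a * b \ini K) ->
  forall r, r \ini idealM I J -> r \ini K.
Proof.
by move=> IJK; apply: ideal_gen_le => r /asboolP[a [b [aI bJ ->]]]; exact: IJK.
Qed.

Lemma idealM_mono I I' J J' : (forall r, r \ini I -> r \ini I') ->
  (forall r, r \ini J -> r \ini J') -> forall r, r \ini idealM I J -> r \ini idealM I' J'.
Proof. by move=> sI sJ; apply: idealM_le => a b /sI aI /sJ; exact: idealM_mem. Qed.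

Lemma idealM_subr I J r : r \ini idealM I J -> r \ini J.
Proof. by apply: idealM_le => a b _; exact: ideal_mull. Qed.

Lemma idealM_subl I J r : r \ini idealM I J -> r \ini I.
Proof. by apply: idealM_le => a b aI _; exact: ideal_mulr. Qed.

Lemma idealM_adj K Y f r : r \ini idealM K (adj Y f) ->
  exists2 a, a \ini K & r - a * f \ini idealM K Y.
Proof.
pose P (r : R^o) := exists2 a, a \ini K & (r : R) - a * f \ini idealM K Y.
have P0 : P 0 by exists 0; rewrite ?mul0r ?subr0; exact: ideal0.
have PZD (c : R) (u v : R^o) : P u -> P v -> P (c *: u + v).
  move=> [a aK ua] [b bK vb]; exists (c * a + b); first by apply: idealD => //; exact: ideal_mull.
  have -> : (c *: u + v : R) - (c * a + b) * f = c * ((u : R) - a * f) + ((v : R) - b * f).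
    by rewrite /GRing.scale /=; ring.
  by apply: idealD => //; exact: ideal_mull.
suff h : forall r, r \ini idealM K (adj Y f) -> r \ini submod_of P0 PZD.
  by move/h/submod_ofP.
apply: idealM_le => a b aK /ideal_adjP[c bc]; apply/submod_ofP.
exists (a * c); first exact: ideal_mulr.
have -> : a * b - a * c * f = a * (b - c * f) by ring.
exact: idealM_mem.
Qed.

Section Powers.
Variable m : ideal R.

Lemma idealXD_mem i j a b : a \ini idealX m i -> b \ini idealX m j ->
  a * b \ini idealX m (i + j).
Proof.
elim: i a => [|i IH] a; first by move=> _; exact: ideal_mull.
move=> aX bX; suff h : forall c, c \ini idealX m i.+1 -> c \ini colon (idealX m (i.+1 + j)) b.
  by have := h a aX.
apply: idealM_le => u v um vX; rewrite mem_colon -mulrA addSn.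
by apply: idealM_mem => //; exact: IH.
Qed.

Lemma idealX_split i j r : r \ini idealX m (i + j) -> r \ini idealM (idealX m i) (idealX m j).
Proof.
elim: i r => [|i IH] r.
  by move=> rX; rewrite -[r]mul1r; apply: idealM_mem => //; exact: ideal_genT.
rewrite addSn; apply: idealM_le => a b am /IH bX.
suff h : forall c, c \ini idealM (idealX m i) (idealX m j) ->
    c \ini colon (idealM (idealX m i.+1) (idealX m j)) a.
  by have := h b bX; rewrite mem_colon mulrC.
apply: idealM_le => u v uX vX; rewrite mem_colon -mulrA [v * a]mulrC mulrA [u * a]mulrC.
by apply: idealM_mem => //; exact: idealM_mem.
Qed.

Lemma idealX_le i j r : (i <= j)%N -> r \ini idealX m j -> r \ini idealX m i.
Proof. by move=> /subnK <- /idealX_split; exact: idealM_subr. Qed.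

Lemma idealX1 r : r \ini m -> r \ini idealX m 1.
Proof. by move=> rm; rewrite -[r]mulr1; apply: idealM_mem => //; exact: ideal_genT. Qed.

Lemma idealX_pos i r : (0 < i)%N -> r \ini idealX m i -> r \ini m.
Proof. by case: i => // i _; exact: idealM_subl. Qed.

End Powers.

Definition gen (xs : seq R) : ideal R := ideal_gen (mem xs).

Lemma gen_nil : gen [::] = sub0 R^o.
Proof.
apply: submod_anti => r; first by apply: ideal_gen_le.
by move/sub0P => ->; exact: ideal0.
Qed.

Lemma gen_cons x xs : gen (x :: xs) = adj (gen xs) x.
Proof.
apply: submod_anti => r.
  apply: ideal_gen_le => {}r; rewrite inE => /predU1P[->|rxs]; first exact: adj_mem.
  by apply: ideal_sub_adj; exact: ideal_gen_mem.
apply: adj_le; last by apply: ideal_gen_mem; exact: mem_head.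
by move=> {}r; apply: ideal_gen_le => {}r rxs; apply: ideal_gen_mem; rewrite inE rxs orbT.
Qed.

Lemma gen_rcons xs x : gen (rcons xs x) = adj (gen xs) x.
Proof.
by rewrite -gen_cons; apply: submod_anti => r; apply: ideal_gen_le => {}r rxs;
   apply: ideal_gen_mem; move: rxs; rewrite !(mem_rcons, inE).
Qed.

Definition adjs Y xs : ideal R := foldl (@adj R R^o) Y xs.

Lemma adjs_adj Y x xs : adjs (adj Y x) xs = adj (adjs Y xs) x.
Proof. by elim: xs Y => //= y xs IH Y; rewrite adjC IH. Qed.

Lemma sub_adjs Y xs r : r \ini Y -> r \ini adjs Y xs.
Proof. by elim: xs Y => //= x xs IH Y rY; apply: IH; exact: ideal_sub_adj. Qed.

Lemma mem_adjs Y xs x : x \in xs -> x \ini adjs Y xs.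
Proof.
elim: xs Y => //= y xs IH Y; rewrite inE => /predU1P[->|/IH //].
by apply: sub_adjs; exact: adj_mem.
Qed.

Lemma adjs0 xs : adjs (sub0 R^o) xs = gen xs.
Proof.
elim: xs => [|x xs IH]; first by rewrite gen_nil.
by rewrite [LHS]adjs_adj IH gen_cons.
Qed.

End IdealOperations.

Section Noetherian.
Variable R : comNzRingType.
Hypothesis noethR : noetherian R.
Implicit Types (I J : ideal R).

Lemma noetherian_gen I : exists xs, I = gen xs.
Proof. by have [xs Ixs] := noethR I; exists xs; exact: submod_ext. Qed.

(** The union of the sequence is finitely generated, so some term contains it. *)
Lemma noetherian_acc (s : nat -> ideal R) :
  (forall n r, r \ini s n -> r \ini s n.+1) ->
  exists n, forall k r, r \ini s k -> r \ini s n.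
Proof.
move=> incs; have mono i j r : (i <= j)%N -> r \ini s i -> r \ini s j.
  by move=> /subnK <-; elim: (j - i)%N => // d IH /IH; exact: incs.
pose P (r : R^o) := exists n, r \ini s n.
have P0 : P 0 by exists 0%N; exact: ideal0.
have PZD (c : R) (u v : R^o) : P u -> P v -> P (c *: u + v).
  move=> [i ui] [j vj]; exists (maxn i j); apply: idealD.
    by apply: ideal_mull; apply: mono ui; exact: leq_maxl.
  by apply: mono vj; exact: leq_maxr.
have [xs Uxs] := noetherian_gen (submod_of P0 PZD).
suff [n hn] : exists n, forall r, r \in xs -> r \ini s n.
  exists n => k r rk; have : r \ini submod_of P0 PZD by apply/submod_ofP; exists k.
  by rewrite Uxs; apply: ideal_gen_le.
have : forall r, r \in xs -> P r.
  by move=> r rxs; apply/(submod_ofP P0 PZD); rewrite Uxs; exact: ideal_gen_mem.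
elim: xs {Uxs} => [|x xs IH] hP; first by exists 0%N.
have [i xi] := hP x (mem_head _ _).
have [|j hj] := IH; first by move=> r rxs; apply: hP; rewrite inE rxs orbT.
exists (maxn i j) => r; rewrite inE => /predU1P[->|/hj].
  by apply: mono xi; exact: leq_maxl.
by apply: mono; exact: leq_maxr.
Qed.

(** Every nonempty family of ideals has a maximal member: otherwise, choosing a
    larger member again and again gives an increasing sequence that never stops. *)
Lemma noetherian_max (F : ideal R -> Prop) I : F I ->
  exists M, [/\ F M, forall r, r \ini I -> r \ini M &
    forall J, F J -> (forall r, r \ini M -> r \ini J) -> forall r, r \ini J -> r \ini M].
Proof.
move=> FI; apply: contrapT => noM.
have step (M : {M | F M /\ forall r, r \ini I -> r \ini M}) :
    exists J : {M | F M /\ forall r, r \ini I -> r \ini M},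
    (forall r, r \ini sval M -> r \ini sval J) /\
    ~ (forall r, r \ini sval J -> r \ini sval M).
  case: M => M [FM IM] /=; apply: contrapT => noJ; apply: noM; exists M; split=> // J FJ MJ.
  apply: contrapT => nJM; apply: noJ.
  by exists (exist _ J (conj FJ (fun r rI => MJ r (IM r rI)))).
have [g hg] := choice step.
pose s n := iter n g (exist _ I (conj FI (fun r rI => rI))).
have [|n hn] := @noetherian_acc (fun n => sval (s n)).
  by move=> n r; apply: (proj1 (hg (s n))).
exact: (proj2 (hg (s n))) (hn n.+1).
Qed.

End Noetherian.

(** * Nakayama's lemma *)

Section Local.
Variables (R : comNzRingType) (m : ideal R).
Hypotheses (noethR : noetherian R) (locm : local_ring m).
Implicit Types (I J E : ideal R).

(** A non-unit generates a proper ideal, which lies in a maximal one. *)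
Lemma local_unit u : ~ u \ini m -> exists v, v * u = 1.
Proof.
move=> num; apply: contrapT => nv; pose I : ideal R := adj (sub0 R^o) u.
have propI : is_proper I.
  apply/negP => /ideal_adjP[v /sub0P/eqP]; rewrite subr_eq0 => /eqP v1.
  by apply: nv; exists v.
have [M [propM IM maxM]] := noetherian_max noethR (F := fun J => is_proper J) propI.
have maximalM : maximal_ideal M.
  split=> // J propJ MJ r; apply/idP/idP => [|/MJ //]; exact: maxM.
by apply: num; rewrite -(proj2 locm M maximalM); apply: IM; exact: adj_mem.
Qed.

Lemma local_unit_sub1 t : t \ini m -> exists v, v * (1 - t) = 1.
Proof.
move=> tm; apply: local_unit => t1; have /negP := proj1 (proj1 locm); apply.
by rewrite -[X in X \ini _](subrK t); exact: idealD.
Qed.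

(** Generators of [E] modulo [J] are discarded one by one: the last one is a multiple
    of itself by an element of [m], modulo [J] and the others. *)
Lemma nakayama J E :
  (forall e, e \ini E -> e \ini subD J (idealM m E)) -> forall e, e \ini E -> e \ini J.
Proof.
move=> EJm; have [us Eus] := noetherian_gen noethR E.
have : forall e, e \ini E -> e \ini adjs J us.
  by move=> e; rewrite Eus; apply: ideal_gen_le => u; exact: mem_adjs.
have : forall u, u \in us -> u \ini E by move=> u uus; rewrite Eus; exact: ideal_gen_mem.
elim: us {Eus} => // u us IH usE; rewrite [adjs J _]adjs_adj => Eu.
have uE : u \ini E by apply: usE; exact: mem_head.
apply: IH => [v vus|]; first by apply: usE; rewrite inE vus orbT.
set K := adjs J us in Eu *.
suff uK : u \ini K by move=> e /Eu; apply: adj_le.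
have /subDP[j jJ] := EJm u uE.
have mEK w : w \ini idealM m E -> w \ini idealM m (adj K u).
  by apply: idealM_mono.
case/mEK/idealM_adj => t tm /idealM_subr jK.
have [v v1] := local_unit_sub1 tm.
rewrite -[u]mul1r -v1 -mulrA; apply: ideal_mull.
have -> : (1 - t) * u = (u - j - t * u) + j by ring.
by apply: idealD => //; exact: sub_adjs.
Qed.

End Local.

(** * The Artin-Rees lemma and Krull's intersection theorem *)

Section HilbertBasis.
Variable R : comNzRingType.
Hypothesis noethR : noetherian R.
Local Notation polyR := ({poly R} : comNzRingType).
Implicit Types K : ideal polyR.
Variable J : ideal polyR.

(** The leading coefficients in degree [n], together with [0]: bounding the degree
    instead of prescribing it makes them an ideal. *)
Definition lead_of K n (r : R^o) :=
  exists p, [/\ p \ini K, (size p <= n.+1)%N & p`_n = r].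

Fact lead_of0 K n : lead_of K n 0.
Proof. by exists 0; rewrite size_poly0 coef0; split=> //; exact: ideal0. Qed.
Fact lead_ofZD K n a u v : lead_of K n u -> lead_of K n v -> lead_of K n (a *: u + v).
Proof.
move=> [p [pK sp <-]] [q [qK sq <-]]; exists (a%:P * p + q); split.
- by apply: idealD => //; exact: ideal_mull.
- rewrite (leq_trans (size_polyD _ _)) // geq_max sq andbT mul_polyC.
  exact: leq_trans (size_scale_leq _ _) sp.
- by rewrite coefD coefCM.
Qed.
Definition lead_ideal K n : ideal R := submod_of (lead_of0 K n) (@lead_ofZD K n).

Lemma lead_idealS K n r : r \ini lead_ideal K n -> r \ini lead_ideal K n.+1.
Proof.
move=> /submod_ofP[p [pK sp <-]]; apply/submod_ofP; exists (p * 'X); split.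
- exact: ideal_mulr.
- by apply: leq_trans (size_polyMleq _ _) _; rewrite size_polyX addn2.
- by rewrite coefMX.
Qed.

Lemma lead_ideal_le K n k r : (n <= k)%N -> r \ini lead_ideal K n -> r \ini lead_ideal K k.
Proof. by move=> /subnK <-; elim: (k - n)%N => // d IH /IH; exact: lead_idealS. Qed.

Lemma lead_ideal_mono K K' n r : (forall p, p \ini K -> p \ini K') ->
  r \ini lead_ideal K n -> r \ini lead_ideal K' n.
Proof.
by move=> sK /submod_ofP[p [/sK pK sp pn]]; apply/submod_ofP; exists p.
Qed.

Lemma lead_ideal_gen n : exists ps : seq {poly R}, (forall p, p \in ps -> p \ini J) /\
  forall r, r \ini lead_ideal J n -> r \ini lead_ideal (gen ps) n.
Proof.
have [rs Ers] := noetherian_gen noethR (lead_ideal J n).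
suff [ps [psJ hps]] : exists ps : seq {poly R}, (forall p, p \in ps -> p \ini J) /\
    forall r, r \in rs -> r \ini lead_ideal (gen ps) n.
  by exists ps; split=> // r; rewrite Ers; exact: ideal_gen_le.
have : forall r, r \in rs -> lead_of J n r.
  move=> r rrs; apply/(submod_ofP (lead_of0 J n) (@lead_ofZD J n)).
  by rewrite -/(lead_ideal J n) Ers; exact: ideal_gen_mem.
elim: rs {Ers} => [|r rs IH] hrs; first by exists [::].
have [p [pJ sp pn]] := hrs r (mem_head _ _).
have [|ps [psJ hps]] := IH; first by move=> q qrs; apply: hrs; rewrite inE qrs orbT.
exists (p :: ps); split=> q; first by rewrite inE => /predU1P[->|/psJ].
rewrite inE gen_cons => /predU1P[->|/hps].
  by apply/submod_ofP; exists p; split=> //; exact: adj_mem.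
by apply: lead_ideal_mono => u; exact: ideal_sub_adj.
Qed.

Lemma lead_ideals_gen n : exists ps : seq {poly R}, (forall p, p \in ps -> p \ini J) /\
  forall i r, (i <= n)%N -> r \ini lead_ideal J i -> r \ini lead_ideal (gen ps) i.
Proof.
have genS (ps qs : seq {poly R}) : {subset ps <= qs} ->
    forall p, p \ini gen ps -> p \ini gen qs.
  by move=> spq; apply: ideal_gen_le => p /spq; exact: ideal_gen_mem.
elim: n => [|n [ps [psJ hps]]].
  have [ps [psJ hps]] := lead_ideal_gen 0; exists ps; split=> // i r.
  by rewrite leqn0 => /eqP ->; exact: hps.
have [qs [qsJ hqs]] := lead_ideal_gen n.+1; exists (ps ++ qs); split=> [p|i r].
  by rewrite mem_cat => /orP[/psJ|/qsJ].
rewrite leq_eqVlt => /predU1P[->|lti] rJ.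
  by apply: lead_ideal_mono (hqs r rJ) => p; apply: genS => q; rewrite mem_cat orbC => ->.
by apply: lead_ideal_mono (hps i r lti rJ) => p; apply: genS => q; rewrite mem_cat => ->.
Qed.

(** The ideals of leading coefficients stabilise at some [c]; polynomials whose
    leading coefficients generate those of index at most [c] generate [J], since
    any element of [J] can be reduced by them to one of smaller degree. *)
Lemma poly_ideal_gen : exists ps : seq {poly R}, J =i gen ps.
Proof.
have [c hc] := noetherian_acc noethR (@lead_idealS J).
have [ps [psJ hps]] := lead_ideals_gen c.
have sJ p : p \ini gen ps -> p \ini J by exact: ideal_gen_le.
exists ps => p; apply/idP/idP => [|/sJ //].
have [n] := ubnP (size p); elim: n p => // n IH p; rewrite ltnS => sp pJ.
have [->|p0] := eqVneq p 0; first exact: ideal0.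
set d := (size p).-1; have sp1 : size p = d.+1 by rewrite prednK // size_poly_gt0.
have pd : p`_d \ini lead_ideal J d by apply/submod_ofP; exists p; rewrite sp1.
have [q [qps sq qd]] : lead_of (gen ps) d p`_d.
  apply/(submod_ofP (lead_of0 _ _) (@lead_ofZD _ _)).
  have [dc|cd] := leqP d c; first exact: hps.
  by apply: (lead_ideal_le (ltnW cd)); apply: hps => //; exact: hc pd.
rewrite -[p](subrK q); apply: idealD => //; apply: IH.
  apply: leq_trans sp; rewrite sp1 ltnS; apply/leq_sizeP => j.
  rewrite leq_eqVlt => /predU1P[<-|dj]; first by rewrite coefB qd subrr.
  by rewrite coefB !nth_default ?subr0 // ?sp1 // (leq_trans sq).
by apply: idealB => //; exact: sJ.
Qed.

End HilbertBasis.

Lemma noetherian_poly (R : comNzRingType) : noetherian R -> noetherian {poly R}.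
Proof. by move=> noethR J; exact: poly_ideal_gen. Qed.

Section ArtinRees.
Variables (R : comNzRingType) (m : ideal R).
Hypothesis noethR : noetherian R.

Definition in_rees (p : {poly R}) := forall i, p`_i \ini idealX m i.

Lemma in_reesM p q : in_rees p -> in_rees q -> in_rees (p * q).
Proof.
move=> hp hq i; rewrite coefM; apply: ideal_sum => j.
by rewrite -[X in idealX m X](subnKC (leq_ord j)); apply: idealXD_mem.
Qed.

(** The Rees algebra [R[mX]] is the image of a Noetherian ring, as it is generated
    over [R] by the [t X] with [t] among finitely many generators of [m]. *)
Lemma rees_cover (ts : seq R) : (forall t, t \in ts -> t \ini m) ->
  exists (S : comNzRingType) (ev : {rmorphism S -> {poly R}}),
  [/\ noetherian S, forall s, in_rees (ev s), forall r, exists s, ev s = r%:P &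
      forall t, t \in ts -> exists s, ev s = t *: 'X].
Proof.
elim: ts => [|t ts IH] tsm.
  exists R, polyC; split=> // [r i|r]; last by exists r.
  by rewrite coefC; case: i => [|i]; [exact: ideal_genT | exact: ideal0].
have [|S [ev [noethS evm evC evX]]] := IH.
  by move=> u uts; apply: tsm; rewrite inE uts orbT.
have cfu : commr_rmorph ev (t *: 'X) by move=> s; exact: mulrC.
exists {poly S}, (horner_morph cfu); split.
- exact: noetherian_poly.
- have tX : in_rees (t *: 'X).
    move=> i; rewrite coefZ coefX; case: eqP => [->|_]; last by rewrite mulr0; exact: ideal0.
    by rewrite mulr1; apply: idealX1; apply: tsm; exact: mem_head.
  elim/poly_ind => [|p s hp]; first by rewrite rmorph0 => i; rewrite coef0; exact: ideal0.
  rewrite rmorphD rmorphM /= horner_morphX horner_morphC => i.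
  by rewrite coefD; apply: idealD; [exact: in_reesM | exact: evm].
- by move=> r; have [s <-] := evC r; exists s%:P; rewrite /= horner_morphC.
move=> u; rewrite inE => /predU1P[->|/evX[s <-]].
  by exists 'X; rewrite /= horner_morphX.
by exists s%:P; rewrite /= horner_morphC.
Qed.

(** The polynomials of the Rees algebra with coefficients in [I] form an ideal; its
    preimage in the Noetherian ring above is generated by finitely many elements, whose
    images have degree less than some [c].  An element [a] of [m ^ n] and [I], seen as
    [a X^n], is a combination of these images, and comparing coefficients of [X^n]
    writes it as a combination of elements of [I] in [m ^ l] with coefficients in
    [m ^ (n - l)], for various [l < c]. *)
Lemma artin_rees_exists (I : ideal R) : exists c, forall n, (c <= n)%N ->
  idealI (idealX m n) I =i idealM (idealX m (n - c)) (idealI (idealX m c) I).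
Proof.
have [ts mts] := noetherian_gen noethR m.
have [|S [ev [noethS evm evC evX]]] := rees_cover (ts := ts).
  by move=> t tts; rewrite mts; exact: ideal_gen_mem.
have evXn n a : a \ini idealX m n -> exists s, ev s = a *: 'X^n.
  pose P n (a : R^o) := exists s, ev s = a *: 'X^n.
  have P0 k : P k 0 by exists 0; rewrite rmorph0 scale0r.
  have PZD k (c : R) (u v : R^o) : P k u -> P k v -> P k (c *: u + v).
    move=> [s es] [t et]; have [r er] := evC c; exists (r * s + t).
    by rewrite rmorphD rmorphM /= es et er scalerDl mul_polyC scalerA.
  suff h k b : b \ini idealX m k -> b \ini submod_of (P0 k) (@PZD k).
    by move/h/submod_ofP.
  elim: k b => [|k IH] b.
    by move=> _; apply/submod_ofP; have [s es] := evC b; exists s; rewrite es expr0 alg_polyC.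
  apply: idealM_le => u v um /IH/submod_ofP[s es]; apply/submod_ofP.
  suff [t et] : exists t, ev t = u *: 'X.
    by exists (t * s); rewrite rmorphM /= es et -scalerAl -scalerAr scalerA -exprS.
  suff /submod_ofP[t et] : u \ini submod_of (P0 1%N) (@PZD 1%N) by exists t; rewrite et expr1.
  move: u um; rewrite mts; apply: ideal_gen_le => t /evX[r er].
  by apply/submod_ofP; exists r; rewrite er expr1.
pose Q (s : S^o) := forall i, (ev s)`_i \ini I.
have Q0 : Q 0 by move=> i; rewrite rmorph0 coef0; exact: ideal0.
have QZD (c u v : S^o) : Q u -> Q v -> Q (c *: u + v).
  move=> hu hv i; rewrite rmorphD rmorphM coefD; apply: idealD => //.
  by rewrite coefM; apply: ideal_sum => j; exact: ideal_mull.
have [ss Ess] := noetherian_gen noethS (submod_of Q0 QZD).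
pose c := \max_(s <- ss) size (ev s); exists c => n lecn a; apply/idP/idP; last first.
  apply: idealM_le => u v uX /andP[vX vI].
  by apply/andP; split; [rewrite /= -(subnK lecn); exact: idealXD_mem | exact: ideal_mull].
move=> /andP[/evXn[s es] aI].
have -> : a = (ev s)`_n by rewrite es coefZ coefXn eqxx mulr1.
have sQ : s \ini gen ss.
  rewrite -Ess; apply/submod_ofP => i; rewrite es coefZ coefXn.
  by apply: ideal_mulr.
pose K k := idealM (idealX m (k - c)) (idealI (idealX m c) I).
pose P (s : S^o) := forall (r : S) k, (c <= k)%N -> (ev (r * (s : S)))`_k \ini K k.
have P0 : P 0 by move=> r k _; rewrite mulr0 rmorph0 coef0; exact: ideal0.
have PZD (b u v : S^o) : P u -> P v -> P (b *: u + v).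
  move=> hu hv r k lek; have -> : r * (b *: u + v : S) = (r * b) * (u : S) + r * (v : S).
    by rewrite mulrDr -mulrA.
  by rewrite rmorphD coefD; apply: idealD; [exact: hu | exact: hv].
suff : s \ini submod_of P0 PZD.
  by move/submod_ofP => /(_ 1 n lecn); rewrite mul1r.
apply: ideal_gen_le sQ => {es aI}s sss; apply/submod_ofP => r k lek.
have sz : (size (ev s) <= c)%N by apply: (leq_bigmax_seq (F := fun s => size (ev s))).
have sI : Q s.
  by apply/(submod_ofP Q0 QZD); rewrite Ess; exact: ideal_gen_mem.
rewrite rmorphM coefM; apply: ideal_sum => j.
(* only coefficients of index l < c of a generator can be nonzero *)
have [lt_c|c_le] := ltnP (k - j)%N c; last first.
  by rewrite [X in _ * X]nth_default ?(leq_trans sz) // mulr0; exact: ideal0.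
have [l El] : exists l, (k - j)%N = l by exists (k - j)%N.
rewrite El in lt_c *.
have rj : (ev r)`_j \ini idealX m ((k - c) + (c - l)).
  have jk := leq_ord j; have -> : (k - c + (c - l))%N = j by lia.
  exact: evm.
suff : (ev r)`_j \ini colon (K k) (ev s)`_l by [].
move: rj => /idealX_split; apply: idealM_le => u v uX vX; rewrite mem_colon -mulrA.
apply: idealM_mem => //; apply/andP; split; last exact: ideal_mull.
by rewrite /= -(subnK (ltnW lt_c)); apply: idealXD_mem => //; exact: evm.
Qed.

Hypothesis locm : local_ring m.

(** The intersection [E] of the [J + m ^ n] satisfies [E = J + m E], since elements of
    [E] that lie deep enough are in [m E] by Artin-Rees for [E]. *)
Lemma krull (J : ideal R) r : (forall n, r \ini subD J (idealX m n)) -> r \ini J.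
Proof.
move=> rJ; pose P (r : R^o) := forall n, r \ini subD J (idealX m n).
have P0 : P 0 by move=> n; exact: ideal0.
have PZD (b u v : R^o) : P u -> P v -> P (b *: u + v).
  by move=> hu hv n; apply: idealD => //; exact: ideal_mull.
pose E : ideal R := submod_of P0 PZD.
suff h : forall e, e \ini E -> e \ini J by apply: h; apply/submod_ofP.
have [c hc] := artin_rees_exists E.
apply: (nakayama noethR locm) => e eE.
have /submod_ofP/(_ c.+1)/subDP[j jJ jX] := eE.
apply/subDP; exists j => //.
have : e - j \ini idealI (idealX m c.+1) E.
  apply/andP; split=> //; apply: idealB => //; apply/submod_ofP => n; exact: subDl.
rewrite hc // subSnn; apply: idealM_mono => u; last by case/andP.
exact: idealX_pos.
Qed.

End ArtinRees.

(** * Colon ideals under perturbation *)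

Section ColonLength.
Variable R : comNzRingType.
Implicit Types (A B I J Y : ideal R) (f z : R).

Lemma sub_colon I z r : r \ini I -> r \ini colon I z.
Proof. by rewrite mem_colon; exact: ideal_mulr. Qed.

(** The isomorphism of [(A + B) / B] with [A / (A :&: B)]. *)
Lemma len_diamond (V : lmodType R) (A B : submodClosed V) :
  (fin_len B (subD A B) <-> fin_len (subI A B) A) /\ len B (subD A B) = len (subI A B) A.
Proof.
apply: (len_matches (rho := fun v w => v - w \in B)).
- split=> [|a u v u' v' h1 h2]; first by rewrite subrr rpred0.
  have -> : a *: u + v - (a *: u' + v') = a *: (u - u') + (v - v').
    by rewrite scalerBr opprD addrACA.
  by rewrite rpredD ?rpredZ.
- exact: subDr.
- by move=> v /subIP[].
split=> [v /subDP[a aA vB]|w wA|v w vAB wA vw]; first by exists a.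
  by exists w; [exact: subDl | rewrite subrr rpred0].
apply/idP/subIP => [vB|[_ wB]]; first by split=> //; exact: rpredBr_sub vB.
exact: rpredBl_sub wB.
Qed.

(** [((Y,f):z) / (Y,f)] has the submodule [((Y:z) + (Y,f)) / (Y,f)], and the
    quotient by it is [((Y,z):f) / ((Y:f) + (z))]: both measure the relations
    [r z = g f] modulo [Y], in terms of [r] and of [g] respectively. *)
Section Split.
Variables (Y : ideal R) (f z : R).
Let I := adj Y f.
Let W : ideal R := colon Y z.
Let V : ideal R := colon Y f.

Lemma colon_sum_le r : r \ini subD W I -> r \ini colon I z.
Proof.
by apply: subD_le => {}r; [rewrite !mem_colon; exact: ideal_sub_adj | exact: sub_colon].
Qed.

Lemma colon_swap r g : r * z - g * f \ini Y ->
  (r \ini subD W I) = (g \ini adj V z).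
Proof.
move=> rg; apply/subDP/ideal_adjP => [[w wW /ideal_adjP[k kY]]|[k]].
  exists k; rewrite mem_colon.
  have -> : (g - k * z) * f = w * z + (r - w - k * f) * z - (r * z - g * f) by ring.
  by apply: idealB => //; apply: idealD => //; exact: ideal_mulr.
rewrite mem_colon => kV; exists (r - k * f).
  rewrite mem_colon; have -> : (r - k * f) * z = r * z - g * f + (g - k * z) * f by ring.
  exact: idealD.
by rewrite subKr; exact: ideal_mul_adj.
Qed.

Lemma len_colon_swap :
  (fin_len (subD W I) (colon I z) <-> fin_len (adj V z) (colon (adj Y z) f)) /\
  len (subD W I) (colon I z) = len (adj V z) (colon (adj Y z) f).
Proof.
apply: (len_matches (rho := fun r g : R^o => (r : R) * z - (g : R) * f \ini Y)).
- split=> [|a u v u' v' h1 h2]; first by rewrite !mul0r subrr ideal0.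
  have -> : (a *: u + v : R) * z - (a *: u' + v' : R) * f =
      a * ((u : R) * z - (u' : R) * f) + ((v : R) * z - (v' : R) * f).
    by rewrite /GRing.scale /=; ring.
  by apply: idealD => //; exact: ideal_mull.
- exact: colon_sum_le.
- apply: adj_le => [g gV|]; first by apply: ideal_sub_adj.
  by rewrite mem_colon mulrC; exact: ideal_mul_adj.
split=> [r /ideal_adjP[g rg]|g /ideal_adjP[r gr]|r g _ _]; last exact: colon_swap.
- exists g => //; rewrite mem_colon; apply/ideal_adjP; exists r.
  by rewrite -opprB; exact: idealN.
- exists r; last by rewrite -opprB; exact: idealN.
  by rewrite mem_colon; apply/ideal_adjP; exists g; rewrite -opprB; exact: idealN.
Qed.

Lemma len_colon_split : fin_len I (colon I z) ->
  len I (colon I z) = (len (subI W I) W + len (adj V z) (colon (adj Y z) f))%N.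
Proof.
move=> fI; rewrite (len_add (N := subD W I)) //; first last.
- by move=> r /colon_sum_le.
- exact: subDr.
by rewrite (proj2 (len_diamond W I)) (proj2 len_colon_swap).
Qed.

End Split.
End ColonLength.

Section Perturbation.
Variables (R : comNzRingType) (m : ideal R).
Hypotheses (noethR : noetherian R) (locm : local_ring m).
Implicit Types (A B I J L Y : ideal R) (f z e : R) (xs ys : seq R).

Definition kills n A B := forall t r, t \ini idealX m n -> r \ini A -> t * r \ini B.

(** A consequence of [ar_m(I) < N] that is preserved by perturbing [I]. *)
Definition ar_lt N I :=
  forall k p, p \ini idealX m (N + k) -> p \ini I -> p \ini idealM (idealX m k.+1) I.

Lemma kills_le i j A B : (i <= j)%N -> kills i A B -> kills j A B.
Proof. by move=> ij h t r /(idealX_le ij); exact: h. Qed.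

Lemma killsD i j A B K : kills i A B -> kills j B K -> kills (i + j) A K.
Proof.
move=> hi hj t r /[1!addnC] /idealX_split tX rA.
suff : t \ini colon K r by [].
by move: tX; apply: idealM_le => u v uX vX; rewrite mem_colon -mulrA; apply: hj => //; exact: hi.
Qed.

Lemma artin_rees_lt N I : (artin_rees m I < N)%N -> ar_lt N I.
Proof.
have [c hc] := artin_rees_exists m noethR I.
have [har _] := least_spec (P := fun c => forall n, (c <= n)%N ->
  idealI (idealX m n) I =i idealM (idealX m (n - c)) (idealI (idealX m c) I)) hc.
move=> arN k p pX pI.
have : p \ini idealI (idealX m (N + k)) I by apply/andP.
rewrite har; last by rewrite (leq_trans (ltnW arN)) ?leq_addr.
apply: idealM_mono => r; last by case/andP.
by apply: idealX_le; rewrite -/(artin_rees m I); lia.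
Qed.

Section OneElement.
Variables (Y : ideal R) (f f' : R) (N : nat).
Hypotheses (ff' : f' - f \ini idealX m N) (arI : ar_lt N (adj Y f)).

(** If [m ^ N (Y:f)] is in [Y] then [Y:f] is contained in [Y:f'] at once.  For the
    other inclusion, an element [u + w] of [Y:f'], with [u] in [Y:f] and [w] in
    [m ^ k], has [w f = - w (f' - f)] modulo [Y], which lies so deep that the
    Artin-Rees condition replaces [w] by an element of [m ^ k.+1]; conclude with
    Krull's theorem. *)
Lemma colon_perturb : kills N (colon Y f) Y -> colon Y f = colon Y f'.
Proof.
move=> killV; have Vf' u : u \ini colon Y f -> u * f' \ini Y.
  move=> uV; have -> : u * f' = (f' - f) * u + u * f by ring.
  by apply: idealD => //; exact: killV.
apply: submod_anti => [u /Vf' //|r rV'].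
apply: (krull noethR locm) => n; elim: n => [|n /subDP[u uV wX]].
  by apply: subDr; exact: ideal_genT.
set w := r - u in wX.
have wf' : w * f' \ini Y by rewrite mulrBl; apply: idealB => //; exact: Vf'.
have : w * (f' - f) \ini idealM (idealX m n.+1) (adj Y f).
  apply: arI; first by rewrite addnC; exact: idealXD_mem.
  rewrite mulrBr; apply: idealB; first exact: ideal_sub_adj.
  exact: ideal_mul_adj.
case/idealM_adj => a aX /idealM_subr awY.
apply/subDP; exists (u + (w + a)); last first.
  have -> : r - (u + (w + a)) = - a by rewrite /w; ring.
  exact: idealN.
apply: idealD => //; rewrite mem_colon.
have -> : (w + a) * f = w * f' - (w * (f' - f) - a * f) by ring.
exact: idealB.
Qed.

(** An element [p = a f' + b] of the perturbed ideal lying in [m ^ (N + k)] can be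
    rewritten with [a] in [m ^ k.+1], improving [a] by one power at a time: the
    correction of [a] is in [Y:f], hence harmless.  Then [a f + b] is as deep as
    [p], and the condition for the original ideal shows that [p] is in
    [m ^ k.+1 (Y,f')] up to an element of [m ^ (N + k).+1]. *)
Lemma ar_lt_perturb : kills N (colon Y f) Y -> ar_lt N (adj Y f').
Proof.
move=> killV k p; have killV' a : a \ini colon Y f -> a * (f' - f) \ini Y.
  by move=> aV; rewrite mulrC; exact: killV.
pose J := idealM (idealX m k.+1) (adj Y f').
have improve n q l : q \ini idealX m (N + n) -> q \ini adj Y f' -> (l <= n.+1)%N ->
    exists2 a, a \ini idealX m l & q - a * f' \ini Y.
  move=> qX qI; elim: l => [|l IH] ln.
    by have /ideal_adjP[a aY] := qI; exists a => //; exact: ideal_genT.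
  have [a aX aY] := IH (ltnW ln).
  have : q - a * (f' - f) \ini idealM (idealX m l.+1) (adj Y f).
    apply: arI.
      by apply: idealB; [apply: idealX_le qX; lia | rewrite mulrC; exact: idealXD_mem].
    by apply/ideal_adjP; exists a; have -> : q - a * (f' - f) - a * f = q - a * f' by ring.
  case/idealM_adj => c cX /idealM_subr cY; exists c => //.
  have -> : q - c * f' = (q - a * f') - ((q - a * f') - (q - a * (f' - f) - c * f))
      + (a - c) * (f' - f) by ring.
  apply: idealD; first by apply: idealB => //; exact: idealB.
  apply: killV'; rewrite mem_colon.
  have -> : (a - c) * f = (q - a * (f' - f) - c * f) - (q - a * f') by ring.
  exact: idealB.
have deepen n q : (k <= n)%N -> q \ini idealX m (N + n) -> q \ini adj Y f' ->
    exists2 q', q' \ini J & q - q' \ini idealX m (N + n.+1).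
  move=> kn qX qI; have [a aX aY] := improve n q n.+1 qX qI (leqnn _).
  have : q - a * (f' - f) \ini idealM (idealX m n.+1) (adj Y f).
    apply: arI.
      apply: idealB => //; apply: idealX_le (idealXD_mem aX ff'); lia.
    by apply/ideal_adjP; exists a; have -> : q - a * (f' - f) - a * f = q - a * f' by ring.
  case/idealM_adj => c cX cY; exists (c * f' + (q - a * (f' - f) - c * f)).
    have cJ : c * f' + (q - a * (f' - f) - c * f) \ini idealM (idealX m n.+1) (adj Y f').
      apply: idealD; first by apply: idealM_mem => //; exact: adj_mem.
      by apply: idealM_mono cY => // r; exact: ideal_sub_adj.
    by apply: idealM_mono cJ => // r; apply: idealX_le.
  have -> : q - (c * f' + (q - a * (f' - f) - c * f)) = (f' - f) * (a - c) by ring.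
  by apply: idealXD_mem => //; exact: idealB.
move=> pX pI; apply: (krull noethR locm) => n.
have : exists2 j, j \ini J & p - j \ini idealX m (N + (k + n)).
  elim: n => [|n [j jJ pjX]]; first by exists 0; rewrite ?subr0 ?addn0 //; exact: ideal0.
  have [|||i iJ] := deepen (k + n)%N (p - j) => //; first exact: leq_addr.
    by apply: idealB => //; exact: idealM_subr jJ.
  by exists (j + i); [exact: idealD | rewrite opprD addrA addnS].
by case=> j jJ pjX; apply/subDP; exists j => //; apply: idealX_le pjX; lia.
Qed.

End OneElement.

(** The effect on one colon quotient [(Y,f):z / (Y,f)] of perturbing [f].  In the
    splitting of its length, [(Y:f) + (z)] and [(Y,z):f] do not change, by the
    invariance of [Y:f] for [Y] and for [(Y,z)].  Neither does the intersection of
    [Y:z] with [(Y,f)]: the two versions agree modulo [m] times themselves, and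
    Nakayama's lemma applies.  As both parts of the perturbed quotient are still
    killed by [m ^ a], the whole is killed by [m ^ (2 a)]. *)
Section TwoElements.
Variables (Y : ideal R) (f f' z : R) (N al a : nat).
Hypotheses (ff' : f' - f \ini idealX m N) (al_a : (al + a < N)%N).
Hypotheses (killV : kills al (colon Y f) Y)
  (killI : kills a (colon (adj Y f) z) (adj Y f)).
Hypotheses (arI : ar_lt N (adj Y f)) (arIz : ar_lt N (adj (adj Y f) z)).

Let V : ideal R := colon Y f.

(** If [g f = r z] modulo [Y] then [t r = k f] modulo [Y] for some [k], and [t g - k z]
    is in [Y : f]. *)
Lemma syzygy_step t g : t \ini idealX m a -> g \ini colon (adj Y z) f ->
  t * g \ini adj V z.
Proof.
move=> tX /ideal_adjP[r gr].
have rI : r \ini colon (adj Y f) z.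
  by rewrite mem_colon; apply/ideal_adjP; exists g; rewrite -opprB; exact: idealN.
rewrite -(@colon_swap R Y f z (t * r)); first by apply: subDr; exact: killI.
have -> : t * r * z - t * g * f = - (t * (g * f - r * z)) by ring.
by apply: idealN; exact: ideal_mull.
Qed.

Lemma syzygy_kills : kills (al + a) (colon (adj Y z) f) (adj Y z).
Proof.
rewrite addnC; apply: (killsD (B := adj V z)).
  by move=> t r; exact: syzygy_step.
move=> t r tX /ideal_adjP[k kV]; apply/ideal_adjP; exists (t * k).
by rewrite -mulrA -mulrBr; exact: killV.
Qed.

Let V_eq : V = colon Y f'.
Proof. by apply: colon_perturb ff' arI _; apply: kills_le killV; lia. Qed.

Let G_eq : colon (adj Y z) f = colon (adj Y z) f'.
Proof.
apply: colon_perturb ff' _ _; first by rewrite adjC.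
by apply: kills_le syzygy_kills; lia.
Qed.

Let W : ideal R := colon Y z.
Let E := subI W (adj Y f).
Let E' := subI W (adj Y f').

Lemma W_kills : kills a W E.
Proof.
move=> t w tX wW; apply/subIP; split; first exact: ideal_mull.
by apply: killI => //; rewrite mem_colon; exact: ideal_sub_adj.
Qed.

(** [m ^ al] sends such a [k] into [Y : z], then [m ^ a] sends it into [E], and [f' - f]
    has one more factor in [m]. *)
Lemma mul_perturbation k : k * z \ini V -> k * (f' - f) \ini idealM m E.
Proof.
move=> kzV; have kills_E : kills (al + a) (colon V z) E.
  apply: killsD W_kills => t r tX rzV; rewrite mem_colon -mulrA; exact: killV.
suff h u : u \ini idealX m (al + a).+1 -> u \ini colon (idealM m E) k.
  by rewrite mulrC; apply: h; apply: idealX_le ff'.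
apply: idealM_le => v w vm wX; rewrite mem_colon -mulrA.
by apply: idealM_mem => //; exact: kills_E.
Qed.

Lemma inter_perturb : E = E'.
Proof.
have E'E : {subset E' <= E}.
  move=> w /subIP[wW /ideal_adjP[k kY]]; apply/subIP; split=> //.
  have kzV : k * z \ini V.
    rewrite V_eq mem_colon.
    have -> : k * z * f' = w * z - (w - k * f') * z by ring.
    by apply: idealB => //; exact: ideal_mulr.
  have /idealM_subr/subIP[_ kI] := mul_perturbation kzV.
  have -> : w = (w - k * f') + k * (f' - f) + k * f by ring.
  apply: idealD; last exact: ideal_mul_adj.
  by apply: idealD => //; exact: ideal_sub_adj.
apply: submod_anti => //; apply: (nakayama noethR locm) => w wE.
have /subIP[wW /ideal_adjP[k kY]] := wE.
have kzV : k * z \ini V.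
  rewrite mem_colon; have -> : k * z * f = w * z - (w - k * f) * z by ring.
  by apply: idealB => //; exact: ideal_mulr.
have kE := mul_perturbation kzV.
apply/subDP; exists (w + k * (f' - f)); last first.
  have -> : w - (w + k * (f' - f)) = - (k * (f' - f)) by ring.
  exact: idealN.
apply/subIP; split.
  by apply: idealD => //; have /idealM_subr/subIP[] := kE.
have -> : w + k * (f' - f) = (w - k * f) + k * f' by ring.
by apply: idealD; [exact: ideal_sub_adj | exact: ideal_mul_adj].
Qed.

Lemma kills_colon_perturb : kills (2 * a) (colon (adj Y f') z) (adj Y f').
Proof.
rewrite mul2n -addnn; apply: (killsD (B := subD W (adj Y f'))).
  move=> t r tX /ideal_adjP[g rg].
  rewrite (@colon_swap R Y f' z _ (t * g)); last by rewrite -!mulrA -mulrBr; exact: ideal_mull.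
  rewrite -V_eq; apply: syzygy_step => //; rewrite G_eq mem_colon; apply/ideal_adjP.
  by exists r; rewrite -opprB; exact: idealN.
move=> t r tX /subDP[w wW rI]; rewrite -[r](subrK w) mulrDr.
apply: idealD; first exact: ideal_mull.
by have := W_kills tX wW; rewrite inter_perturb => /subIP[].
Qed.

Lemma len_colon_perturb :
  fin_len (adj Y f) (colon (adj Y f) z) -> fin_len (adj Y f') (colon (adj Y f') z) ->
  len (adj Y f') (colon (adj Y f') z) = len (adj Y f) (colon (adj Y f) z).
Proof.
move=> fI fI'; rewrite !len_colon_split // -V_eq -G_eq.
by rewrite -/W -/E -/E' inter_perturb.
Qed.

End TwoElements.

(** * Finite length *)

(** [(B + R u) / B] is zero or a simple module. *)
Lemma fin_len_adj B u : (forall t, t \ini m -> t * u \ini B) -> fin_len B (adj B u).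
Proof.
move=> mu; exists 1%N => -[|[|k]] C [sC bC] //; exfalso.
have [s0 n0] := sC 0%N isT; have [s1 n1] := sC 1%N isT.
have [bB _] := bC 0%N isT; have [_ bA] := bC 2%N isT; have [_ bA1] := bC 1%N isT.
suff uC : u \ini C 1%N by apply: n1 => r /bA; apply: adj_le => // w /bB /s0.
have [c cC1 cC0] : exists2 c, c \ini C 1%N & ~ c \ini C 0%N.
  by apply: contrapT => h; apply: n0 => c cC; apply: contrapT => nc; apply: h; exists c.
have /ideal_adjP[r ru] := bA1 c cC1.
have [v v1] : exists v, v * r = 1.
  apply: (local_unit noethR locm) => rm; apply: cC0; apply: bB.
  by rewrite -[c](subrK (r * u)); apply: idealD => //; exact: mu.
rewrite -[u]mul1r -v1 -mulrA; apply: ideal_mull; rewrite -[r * u](subKr c).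
by apply: idealB => //; apply: s0; exact: bB.
Qed.

(** Each [m ^ i A + B / m ^ i.+1 A + B] is a finite-dimensional vector space over the
    residue field. *)
Lemma fin_len_kills n A B : {subset B <= A} -> kills n A B -> fin_len B A.
Proof.
move=> sBA; elim: n A sBA => [|n IH] A sBA hA.
  suff -> : A = B by exact: fin_len_refl.
  apply: submod_anti => // r rA; rewrite -[r]mul1r; apply: hA => //; exact: ideal_genT.
pose A1 := subD (idealM m A) B.
have A1A : {subset A1 <= A} by apply: subD_le => // r; exact: idealM_subr.
have BA1 : {subset B <= A1} by exact: subDr.
apply: (fin_len_trans BA1 A1A).
  apply: IH => // t r tX /subDP[w wA rB].
  rewrite -[r](subrK w) mulrDr; apply: idealD; first exact: ideal_mull.
  suff : w \ini colon B t by rewrite mem_colon mulrC.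
  move: wA; apply: idealM_le => u v um vA; rewrite mem_colon mulrAC.
  by apply: hA => //; exact: idealM_mem.
have [us Eus] := noetherian_gen noethR A.
have us_mem u : u \in us -> u \ini A by rewrite Eus => ?; exact: ideal_gen_mem.
apply: (@fin_len_sub _ _ A1 (adjs A1 us)) => //.
  by move=> r; rewrite {1}Eus; apply: ideal_gen_le => u; exact: mem_adjs.
elim: us us_mem {Eus} => [|u us IHus] us_mem; first exact: fin_len_refl.
rewrite [adjs _ _]adjs_adj.
apply: (@fin_len_trans _ _ A1 (adjs A1 us)).
- by move=> r; exact: sub_adjs.
- exact: adj_sub.
- by apply: IHus => v vus; apply: us_mem; rewrite inE vus orbT.
apply: fin_len_adj => t tm; apply: sub_adjs; apply: subDl.
by apply: idealM_mem => //; apply: us_mem; exact: mem_head.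
Qed.

(** * Perturbing a sequence *)

Definition seq_kills L xs (e : nat -> nat) := forall i, (i < size xs)%N ->
  kills (e i) (colon (adjs L (take i xs)) xs`_i) (adjs L (take i xs)).

(** A relation [g f + g_1 y_1 + ... + g_k y_k = 0] has [g_k] in the colon ideal of [y_k],
    so that a power of [m] sends [g_k] into [(f, y_1, ..., y_(k-1))].  Subtracting Koszul
    relations then leaves a relation without [y_k], and the coefficient of [f] has only
    changed by a multiple of [y_k]. *)
Lemma kills_colon_adjs L f ys (e : nat -> nat) : seq_kills L (f :: ys) e ->
  kills (\sum_(i < (size ys).+1) e i) (colon (adjs L ys) f) (adjs L ys).
Proof.
elim/last_ind: ys => [|ys y IH] h; first by rewrite big_ord1; exact: (h 0%N isT).
rewrite /adjs size_rcons big_ord_recr /= foldl_rcons -/(adjs L ys).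
apply: syzygy_kills.
  apply: IH => i lti; have := h i; rewrite -rcons_cons nth_rcons size_rcons lti.
  by rewrite -cats1 takel_cat ?(ltnW lti) //; apply; exact: (leqW lti).
have /= := h (size ys).+1; rewrite size_rcons ltnSn nth_rcons ltnn eqxx.
by rewrite -cats1 take_size_cat // adjs_adj; apply.
Qed.

(** Induction on the sequence.  Perturbing its first element [x] to [x'] and passing to
    [L + (x')] doubles the exponents of the other elements, which matches the factor [2]
    between consecutive coefficients in the bound. *)
Lemma perturb_colons L xs xs' (e : nat -> nat) N : size xs' = size xs ->
  (forall i, (i < size xs)%N -> xs'`_i - xs`_i \ini idealX m N) ->
  seq_kills L xs e ->
  (forall i, (i < size xs)%N -> ar_lt N (adjs L (take i.+1 xs))) ->
  (\sum_(i < size xs) 2 ^ i * e i < N)%N ->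
  seq_kills L xs' (fun i => 2 ^ i * e i)%N /\
  forall i, (i < size xs)%N ->
    len (adjs L (take i xs')) (colon (adjs L (take i xs')) xs'`_i) =
    len (adjs L (take i xs)) (colon (adjs L (take i xs)) xs`_i).
Proof.
elim: xs xs' L e => [|x xs IH] [|x' xs'] //= L e.
case=> sz xx' hk har hN.
have x'x := xx' 0%N isT; have k0 := hk 0%N isT; have ar0 := har 0%N isT.
rewrite /= take0 in x'x k0 ar0.
have sum_le j : (j <= size xs)%N -> (\sum_(i < j.+1) e i < N)%N.
  move=> lej; apply: leq_ltn_trans hN.
  rewrite (big_ord_widen (size xs).+1 e (n1 := j.+1)) // big_mkcond /=.
  apply: leq_sum => i _; case: ifP => // _.
  by rewrite leq_pmull // expn_gt0.
have kx : colon L x = colon L x'.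
  apply: (colon_perturb x'x ar0); apply: kills_le k0.
  by have := sum_le 0%N isT; rewrite big_ord1 => /ltnW.
have kills_x j : (j <= size xs)%N ->
    kills (\sum_(i < j.+1) e i) (colon (adjs L (take j xs)) x) (adjs L (take j xs)).
  move=> lej; have := @kills_colon_adjs L x (take j xs) e.
  rewrite size_takel //; apply=> i /=; rewrite size_takel // => lti.
  have := hk i (leq_trans lti (lej : (j < (size xs).+1)%N)).
  case: i lti => [|i] lti /=; first by [].
  by rewrite nth_take // take_takel // ltnW.
have step j : (j < size xs)%N ->
  let I := adjs (adj L x) (take j xs) in let I' := adjs (adj L x') (take j xs) in
  kills (2 * e j.+1) (colon I' xs`_j) I' /\
  len I' (colon I' xs`_j) = len I (colon I xs`_j).
  move=> ltj I I'; rewrite /I /I' !adjs_adj; set Y := adjs L (take j xs).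
  have kV := kills_x j (ltnW ltj).
  have kI : kills (e j.+1) (colon (adj Y x) xs`_j) (adj Y x).
    by have := hk j.+1 ltj; rewrite /= adjs_adj.
  have arI : ar_lt N (adj Y x).
    by have := har j (ltnW ltj : (j < (size xs).+1)%N); rewrite /= adjs_adj.
  have arIz : ar_lt N (adj (adj Y x) xs`_j).
    have := har j.+1 ltj; rewrite /= (take_nth 0) //.
    by rewrite /adjs foldl_rcons -/(adjs _ _) adjs_adj.
  have lt_N : (\sum_(i < j.+1) e i + e j.+1 < N)%N by have := sum_le j.+1 ltj; rewrite big_ord_recr.
  have kI' := kills_colon_perturb x'x lt_N kV kI arI arIz.
  split=> //; apply: (len_colon_perturb x'x lt_N) => //.
    by apply: fin_len_kills kI => r; exact: sub_colon.
  by apply: fin_len_kills kI' => r; exact: sub_colon.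
have [||||hk' hl'] := IH xs' (adj L x') (fun i => 2 * e i.+1)%N sz.
- by move=> i lti; exact: (xx' i.+1 lti).
- by move=> i lti; exact: (proj1 (step i lti)).
- move=> i lti; rewrite adjs_adj; apply: (ar_lt_perturb x'x).
    by have := har i.+1 lti; rewrite /= adjs_adj.
  by apply: kills_le (kills_x _ lti); apply: ltnW; exact: sum_le.
- apply: leq_ltn_trans hN; rewrite [leqRHS]big_ord_recl /= (leq_trans _ (leq_addl _ _)) //.
  by apply: leq_sum => i _; rewrite /bump /= add1n expnS mulnCA mulnA.
split=> -[|i] lti.
- by rewrite take0 /= mul1n -kx.
- have := hk' i lti; rewrite /= mulnA -expnSr; exact.
- by rewrite take0 /= -kx.
by rewrite /= (hl' i lti) (proj2 (step i lti)).
Qed.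

End Perturbation.

(** * Loewy lengths of filter regular sequences *)

Section Loewy.
Variables (R : comNzRingType) (m : ideal R).
Hypotheses (noethR : noetherian R) (locm : local_ring m).
Implicit Types (A B p : ideal R).

Lemma subquot_scale0 A B (a : R) (u : submod A) :
  (a *: (\pi_(quotmod (@restrict_pred R R^o A B))%qT u : subquot A B) == 0) =
  (a * (val u : R) \ini B).
Proof.
have -> : (0 : subquot A B) = \pi_(quotmod (@restrict_pred R R^o A B))%qT 0 by rewrite raddf0.
rewrite [X in X == _](quotmod_scaleE _ a u) quotmod_eq subr0 inE.
by congr (_ \in _); exact: linearZ_LR.
Qed.

Lemma loewy_kills A B n : kills m n A B -> kills m (loewy_length (subquot A B) m) A B.
Proof.
move=> hn; pose P n := forall (a : R^o) (v : subquot A B), a \in idealX m n -> (a : R) *: v = 0.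
have Pn : P n.
  move=> a v aX; elim/quotW: v => u; apply/eqP.
  by rewrite subquot_scale0; apply: hn => //; exact: (proj2_sig u).
have [hl _] := least_spec Pn; move=> t r tX rA.
have /eqP := hl t (\pi_(quotmod (@restrict_pred R R^o A B))%qT (exist _ r rA)) tX.
by rewrite subquot_scale0.
Qed.

(** If no power of [m] were in the annihilator of [A / B], an ideal maximal among
    those that contain the annihilator but no power of [m] would be prime; it lies
    in the support because [A] is finitely generated, so it would be [m]. *)
Lemma support_kills A B : (forall p, in_support (subquot A B) p -> p =i m) ->
  exists n, kills m n A B.
Proof.
move=> suppm; pose P (t : R^o) := forall r, r \ini A -> (t : R) * r \ini B.
have P0 : P 0 by move=> r _; rewrite mul0r ideal0.
have PZD (c : R) (u v : R^o) : P u -> P v -> P (c *: u + v).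
  move=> hu hv r rA; rewrite mulrDl -mulrA; apply: idealD; last exact: hv.
  by apply: ideal_mull; exact: hu.
pose ann : ideal R := submod_of P0 PZD.
pose no_power (p : ideal R) := forall n, ~ (forall t, t \ini idealX m n -> t \ini p).
apply: contrapT => noN; have ann_no : no_power ann.
  by move=> n h; apply: noN; exists n => t r /h/submod_ofP; apply.
have [p [p_no annp maxp]] := noetherian_max noethR ann_no.
have primep : prime_ideal p.
  split=> [|a b ab]; first by apply/negP => p1; apply: (p_no 0%N) => t _; rewrite -[t]mulr1; exact: ideal_mull.
  have power c : ~ c \ini p -> exists n, forall t, t \ini idealX m n -> t \ini adj p c.
    move=> ncp; apply: contrapT => h; apply: ncp; apply: (maxp (adj p c)) (adj_mem _ _).
      by move=> n hn; apply: h; exists n.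
    by move=> r; exact: ideal_sub_adj.
  have [ap|/negP nap] := boolP (a \ini p); first by apply/orP; left.
  have [bp|/negP nbp] := boolP (b \ini p); first by apply/orP; right.
  have [i hi] := power a nap; have [j hj] := power b nbp.
  case: (p_no (i + j)%N) => t /idealX_split; apply: idealM_le => u v /hi/ideal_adjP[c uc] /hj/ideal_adjP[d vd].
  have -> : u * v = (u - c * a) * v + c * a * (v - d * b) + c * d * (a * b) by ring.
  apply: idealD; last exact: ideal_mull.
  by apply: idealD; [exact: ideal_mulr | exact: ideal_mull].
suff pm : p =i m by apply: (p_no 1%N) => t; rewrite pm; exact: idealX_pos.
apply: suppm; split=> //; apply: contrapT => nf.
have killed r : r \ini A -> exists2 s, ~ s \ini p & s * r \ini B.
  move=> rA; apply: contrapT => h; apply: nf.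
  exists (\pi_(quotmod (@restrict_pred R R^o A B))%qT (exist _ r rA) : subquot A B, 1).
    by case: primep.
  case=> s sp /=; rewrite scaler0 subr0 scale1r => /eqP; rewrite subquot_scale0 => sB.
  by apply: h; exists s => //; exact/negP.
have [us Eus] := noetherian_gen noethR A.
have [s sp ss] : exists2 s, ~ s \ini p & forall u, u \in us -> s * u \ini B.
  have usA u : u \in us -> u \ini A by rewrite Eus; exact: ideal_gen_mem.
  elim: us usA {Eus} => [|u us IH] usA; first by exists 1 => //; apply/negP; case: primep.
  have [|s sp ss] := IH; first by move=> v vus; apply: usA; rewrite inE vus orbT.
  have [s' sp' su] := killed u (usA u (mem_head _ _)).
  exists (s * s') => [|v]; first by case: primep => _ h /h /orP[].
  rewrite inE => /predU1P[->|/ss sv]; first by rewrite -mulrA; exact: ideal_mull.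
  by rewrite mulrAC; exact: ideal_mulr.
apply: sp; apply: annp; apply/submod_ofP => r; rewrite Eus => rA.
suff : r \ini colon B s by rewrite mem_colon mulrC.
by apply: ideal_gen_le rA => u /ss; rewrite mem_colon mulrC.
Qed.

Lemma filter_regular_kills xs : filter_regular m xs ->
  seq_kills m (sub0 R^o) xs (fun i => loewy_length (colon_quot xs i) m).
Proof.
move=> hx i lti; rewrite adjs0.
by have [n hn] := support_kills (hx i lti); exact: loewy_kills hn.
Qed.

End Loewy.

(** * Koszul homology *)

Section ScalarMultiplication.
Variables (R : comNzRingType) (V : lmodType R) (x : R).
Implicit Types A B : submodClosed V.

Fact scolon_0 B : x *: (0 : V) \in B. Proof. by rewrite scaler0 rpred0. Qed.
Fact scolon_ZD B (a : R) (u v : V) :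
  x *: u \in B -> x *: v \in B -> x *: (a *: u + v) \in B.
Proof.
by move=> hu hv; rewrite scalerDr scalerA mulrC -scalerA rpredD // rpredZ.
Qed.
(** [B : x] *)
Definition scolon B := submod_of (scolon_0 B) (@scolon_ZD B).

Fact addmul_0 B A : exists2 w, w \in A & (0 : V) - x *: w \in B.
Proof. by exists 0; rewrite ?scaler0 ?subr0 rpred0. Qed.
Fact addmul_ZD B A (a : R) (u v : V) : (exists2 w, w \in A & u - x *: w \in B) ->
  (exists2 w, w \in A & v - x *: w \in B) ->
  exists2 w, w \in A & a *: u + v - x *: w \in B.
Proof.
move=> [u' uA uB] [v' vA vB]; exists (a *: u' + v'); first by rewrite rpredD ?rpredZ.
have -> : a *: u + v - x *: (a *: u' + v') = a *: (u - x *: u') + (v - x *: v').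
  by rewrite scalerDr scalerBr !scalerA mulrC opprD addrACA.
by rewrite rpredD ?rpredZ.
Qed.
(** [B + x A] *)
Definition addmul B A := submod_of (addmul_0 B A) (@addmul_ZD B A).

Lemma scolonP B v : reflect (x *: v \in B) (v \in scolon B).
Proof. exact: submod_ofP. Qed.

Lemma addmulP B A v : reflect (exists2 w, w \in A & v - x *: w \in B) (v \in addmul B A).
Proof. exact: submod_ofP. Qed.

(** Kernel and cokernel of an endomorphism of a module of finite length have the same
    length, as its image has the length of its coimage. *)
Lemma len_mul_coker B A : {subset B <= A} -> fin_len B A ->
  len (addmul B A) A = len B (subI A (scolon B)).
Proof.
move=> sBA fBA; set K := subI A (scolon B).
have BK : {subset B <= K} by move=> v vB; apply/subIP; split; [exact: sBA | apply/scolonP; rewrite rpredZ].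
have KA : {subset K <= A} by move=> v /subIP[].
have BM : {subset B <= addmul B A}.
  by move=> v vB; apply/addmulP; exists 0; rewrite ?rpred0 // scaler0 subr0.
have MA : {subset addmul B A <= A}.
  by move=> v /addmulP[w wA /sBA vw]; rewrite -[v](subrK (x *: w)) rpredD ?rpredZ.
have [_ img] : (fin_len K A <-> fin_len B (addmul B A)) /\ len K A = len B (addmul B A).
  apply: (len_matches (rho := fun w v => v - x *: w \in B)) => //.
    split=> [|a u v u' v' h1 h2]; first by rewrite scaler0 subr0 rpred0.
    have -> : a *: u' + v' - x *: (a *: u + v) = a *: (u' - x *: u) + (v' - x *: v).
      by rewrite scalerDr scalerBr !scalerA mulrC opprD addrACA.
    by rewrite rpredD ?rpredZ.
  split=> [w wA|v /addmulP[w]|w v wA vM vw]; [|by exists w|].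
    exists (x *: w); last by rewrite subrr rpred0.
    by apply/addmulP; exists w; rewrite // subrr rpred0.
  apply/subIP/idP => [[_ /scolonP xw]|vB]; first exact: rpredBl_sub xw.
  by split=> //; apply/scolonP; exact: rpredBr_sub vB.
have := len_add BK KA fBA; rewrite (len_add BM MA fBA) img; lia.
Qed.
End ScalarMultiplication.

Section Homology.
Variables (R : comNzRingType) (C : free_complex R).
Implicit Types v w : chains C.

Definition cycles n : submodClosed (chains C) := @cycles_pred R C n.
Definition boundaries n : submodClosed (chains C) := @boundaries_pred R C n.

Lemma cyclesP n v : reflect (homog n v /\ diff v = 0) (v \in cycles n).
Proof. exact: asboolP. Qed.

Lemma boundariesP n v : reflect (exists2 w, homog n.+1 w & v = diff w) (v \in boundaries n).
Proof. exact: asboolP. Qed.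

Lemma homog0 n : homog n (0 : chains C).
Proof. by move=> b _; rewrite ffunE. Qed.

Lemma homogZ n (a : R) v : homog n v -> homog n (a *: v).
Proof. by move=> hv; rewrite -[a *: v]addr0; apply: homog_closed => //; exact: homog0. Qed.

Lemma diff_diff v : diff (diff v) = 0.
Proof.
apply/ffunP => b; rewrite !ffunE.
under eq_bigr => a _ do rewrite ffunE mulr_suml.
rewrite exchange_big big1 // => a _ /=.
under eq_bigr => c _ do rewrite -mulrA.
rewrite -mulr_sumr; transitivity (v a * 0); last exact: mulr0.
by congr (_ * _); have := coef_sq a b; exact.
Qed.

Lemma homog_diff n v : homog n.+1 v -> homog n (diff v).
Proof.
move=> hv b nb; rewrite ffunE big1 // => a _.
have [->|/coef_deg da] := eqVneq (coef a b) 0; first by rewrite mulr0.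
by rewrite hv ?mul0r // da eqSS.
Qed.

Lemma diff_homog0 v : homog 0 v -> diff v = 0.
Proof.
move=> hv; apply/ffunP => b; rewrite !ffunE big1 // => a _.
have [->|/coef_deg da] := eqVneq (coef a b) 0; first by rewrite mulr0.
by rewrite hv ?mul0r // da.
Qed.

Lemma boundaries_cycles n : {subset boundaries n <= cycles n}.
Proof.
move=> _ /boundariesP[w hw ->]; apply/cyclesP.
by split; [exact: homog_diff | exact: diff_diff].
Qed.

Lemma homology_len n :
  (finite_length (homology C n) <-> fin_len (boundaries n) (cycles n)) /\
  module_length (homology C n) = len (boundaries n) (cycles n).
Proof. exact: subquot_len (@boundaries_cycles n). Qed.

(** Modulo [boundaries n] this is the kernel of [x] on the homology. *)
Definition killed x n := subI (cycles n) (scolon x (boundaries n)).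

End Homology.

Section TensorKoszul.
Variables (R : comNzRingType) (C : free_complex R) (x : R).
Let T := tensor C (koszul1 x).
Implicit Types v w : chains T.

Definition part (i : bool) v : chains C := [ffun b => v (b, i)].
Definition glue (u0 u1 : chains C) : chains T :=
  [ffun p : C * bool => if p.2 then u1 p.1 else u0 p.1].

Lemma partE i v b : part i v b = v (b, i). Proof. exact: ffunE. Qed.

Lemma chainsT_eq v w : part false v = part false w -> part true v = part true w -> v = w.
Proof.
move=> /ffunP e0 /ffunP e1; apply/ffunP => -[b []].
  by have := e1 b; rewrite !ffunE.
by have := e0 b; rewrite !ffunE.
Qed.

Lemma part0_glue u0 u1 : part false (glue u0 u1) = u0.
Proof. by apply/ffunP => b; rewrite !ffunE. Qed.

Lemma part1_glue u0 u1 : part true (glue u0 u1) = u1.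
Proof. by apply/ffunP => b; rewrite !ffunE. Qed.

Lemma part_linear i (a : R) v w : part i (a *: v + w) = a *: part i v + part i w.
Proof. by apply/ffunP => b; rewrite !ffunE. Qed.

Lemma homog_part n (i : bool) v : homog (n + i)%N v -> homog n (part i v).
Proof. by move=> hv b nb; rewrite ffunE hv //= /tensor_deg /= eqn_add2r. Qed.

Lemma homog_glue n u0 u1 : homog n.+1 u0 -> homog n u1 -> homog n.+1 (glue u0 u1).
Proof.
move=> h0 h1 [b []]; rewrite /= /tensor_deg /= ffunE /=.
  by rewrite addn1 eqSS => /h1.
by rewrite addn0 => /h0.
Qed.

Lemma diffT v b i : diff v (b, i) = \sum_(a : C)
  ((v (a, true) : R) * @tensor_coef R C (koszul1 x) (a, true) (b, i)
   + (v (a, false) : R) * @tensor_coef R C (koszul1 x) (a, false) (b, i)).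
Proof.
rewrite ffunE; transitivity (\sum_(a : C) \sum_(j : bool)
    (v (a, j) : R) * @tensor_coef R C (koszul1 x) (a, j) (b, i)).
  by rewrite pair_bigA; apply: eq_bigr => -[a j].
by apply: eq_bigr => a _; rewrite big_bool.
Qed.

Lemma part1_diff v : part true (diff v) = diff (part true v).
Proof.
apply/ffunP => b; rewrite ffunE diffT ffunE.
apply: eq_bigr => a _; rewrite ffunE /tensor_coef /= /koszul1_coef /=.
by rewrite !mulr0 !addr0 mulr1 mulr0 addr0.
Qed.

(** The sign of the tensor differential depends on the degree of the basis vector,
    which is constant on the support of a homogeneous chain. *)
Lemma part0_diff n v : homog n.+1 v ->
  part false (diff v) = diff (part false v) + ((-1) ^+ n * x) *: part true v.
Proof.
move=> hv; apply/ffunP => b; rewrite [LHS]ffunE diffT !ffunE.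
transitivity (\sum_(a : C) ((v (a, false) : R) * coef a b
    + (a == b)%:R * ((v (a, true) : R) * (-1) ^+ deg a * x))).
  apply: eq_bigr => a _; rewrite /tensor_coef /= /koszul1_coef /=.
  by rewrite !mulr0 !mulr1 !addr0 add0r addrC; congr (_ + _); ring.
rewrite big_split /=; congr (_ + _); first by apply: eq_bigr => a _; rewrite ffunE.
rewrite (bigD1 b) //= eqxx mul1r big1 ?addr0; last by move=> a /negPf ->; rewrite mul0r.
have [db|nb] := eqVneq (deg b) n; first by rewrite db /GRing.scale /=; ring.
by rewrite hv ?scaler0 ?mul0r //= /tensor_deg /= addn1 eqSS.
Qed.

Lemma diff_glue n u0 u1 : homog n.+1 u0 -> homog n u1 ->
  diff (glue u0 u1) = glue (diff u0 + ((-1) ^+ n * x) *: u1) (diff u1).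
Proof.
move=> h0 h1; apply: chainsT_eq; last by rewrite part1_diff !part1_glue.
by rewrite (part0_diff (homog_glue h0 h1)) !part0_glue part1_glue.
Qed.

Lemma chainsT_glue v : v = glue (part false v) (part true v).
Proof. by apply: chainsT_eq; rewrite ?part0_glue ?part1_glue. Qed.

Lemma cyclesT n v : v \in cycles T n.+1 ->
  [/\ homog n.+1 (part false v), part true v \in cycles C n &
      diff (part false v) = - (((-1) ^+ n * x) *: part true v)].
Proof.
move=> /cyclesP[hv dv].
have h0 : homog n.+1 (part false v) by apply: homog_part; rewrite addn0.
have h1 : homog n (part true v) by apply: homog_part; rewrite addn1.
split=> //; first apply/cyclesP; first split=> //.
  by rewrite -part1_diff dv; apply/ffunP => b; rewrite !ffunE.
apply/eqP; rewrite -addr_eq0 -(part0_diff hv) dv; apply/eqP/ffunP => b.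
by rewrite !ffunE.
Qed.

Lemma sign_scale n (u : chains C) : x *: u = ((-1) ^+ n * x) *: ((-1) ^+ n *: u).
Proof.
by rewrite scalerA mulrAC -expr2 sqrr_sign mul1r.
Qed.

Lemma signK n (u : chains C) : ((-1) ^+ n * x) *: u = x *: ((-1) ^+ n *: u).
Proof. by rewrite scalerA mulrC. Qed.

(** The classes that come from [C] in the exact sequence
    [0 -> H_(n+1)(C) / x H_(n+1)(C) -> H_(n+1)(T) -> (kernel of x on H_n(C)) -> 0],
    whose outer maps are [part true] and the inclusion of [C] in [T]. *)
Section Middle.
Variable n : nat.
Fact middle_0 : (0 : chains T) \in cycles T n.+1 /\ part true 0 \in boundaries C n.
Proof.
split; first exact: rpred0.
by have -> : part true 0 = 0 by [apply/ffunP => b; rewrite !ffunE]; exact: rpred0.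
Qed.
Fact middle_ZD (a : R) v w : v \in cycles T n.+1 /\ part true v \in boundaries C n ->
  w \in cycles T n.+1 /\ part true w \in boundaries C n ->
  a *: v + w \in cycles T n.+1 /\ part true (a *: v + w) \in boundaries C n.
Proof.
by case=> h1 h2 [h3 h4]; rewrite part_linear; split; rewrite rpredD // rpredZ.
Qed.
Definition middle := submod_of middle_0 middle_ZD.

Lemma middleP v : reflect (v \in cycles T n.+1 /\ part true v \in boundaries C n)
  (v \in middle).
Proof. exact: submod_ofP. Qed.

Lemma len_upper :
  (fin_len middle (cycles T n.+1) <-> fin_len (boundaries C n) (killed C x n)) /\
  len middle (cycles T n.+1) = len (boundaries C n) (killed C x n).
Proof.
apply: (len_matches (rho := fun v u => part true v = u)).
- split=> [|a u v _ _ <- <-]; last exact: part_linear.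
  by apply/ffunP => b; rewrite !ffunE.
- by move=> v /middleP[].
- move=> u uB; apply/subIP; split; first exact: boundaries_cycles.
  by apply/scolonP; rewrite rpredZ.
split=> [v vZ|u /subIP[uZ /scolonP/boundariesP[w hw xu]]|v u vZ uK <-].
- have [h0 h1 dv] := cyclesT vZ; exists (part true v) => //; apply/subIP; split=> //.
  apply/scolonP/boundariesP; exists (- ((-1) ^+ n *: part false v)).
    by rewrite -scaleN1r; do 2!apply: homogZ.
  by rewrite linearN linearZ /= dv scalerN opprK scalerA mulrA -expr2 sqrr_sign mul1r.
- exists (glue (- ((-1) ^+ n *: w)) u); last exact: part1_glue.
  have /cyclesP[hu du] := uZ.
  have hw' : homog n.+1 (- ((-1) ^+ n *: w)) by rewrite -scaleN1r; do 2!apply: homogZ.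
  apply/cyclesP; split; first exact: homog_glue.
  rewrite (diff_glue hw' hu) du linearN linearZ /= -xu scalerA addNr.
  by apply: chainsT_eq; rewrite ?part0_glue ?part1_glue; apply/ffunP => b; rewrite !ffunE.
apply/middleP/idP => [[]|] //; by split.
Qed.

Lemma len_lower :
  (fin_len (boundaries T n.+1) middle <->
    fin_len (addmul x (boundaries C n.+1) (cycles C n.+1)) (cycles C n.+1)) /\
  len (boundaries T n.+1) middle =
    len (addmul x (boundaries C n.+1) (cycles C n.+1)) (cycles C n.+1).
Proof.
have glue0_cycle z : z \in cycles C n.+1 -> glue z 0 \in cycles T n.+1.
  move=> /cyclesP[hz dz]; apply/cyclesP; split; first exact: homog_glue (@homog0 _ _ _).
  rewrite (diff_glue hz (@homog0 _ _ _)) dz scaler0 addr0 linear0.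
  by apply: chainsT_eq; rewrite ?part0_glue ?part1_glue; apply/ffunP => b; rewrite !ffunE.
apply: (len_matches (rho := fun v z => v - glue z 0 \in boundaries T n.+1)).
- split=> [|a u v u' v' h1 h2].
    by have -> : 0 - glue 0 0 = 0 :> chains T;
      [apply/ffunP => -[b []]; rewrite !ffunE /= subr0 | exact: rpred0].
  have -> : a *: u + v - glue (a *: u' + v') 0 = a *: (u - glue u' 0) + (v - glue v' 0).
    apply/ffunP => -[b []]; rewrite !ffunE /=.
      by rewrite !subr0.
    by rewrite scalerBr opprD addrACA.
  by rewrite rpredD // rpredZ.
- move=> v vB; apply/middleP; split; first exact: boundaries_cycles.
  case/boundariesP: vB => w hw ->; rewrite part1_diff; apply/boundariesP.
  by exists (part true w) => //; apply: homog_part; rewrite addn1.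
- move=> v /addmulP[w wZ vw]; rewrite -[v](subrK (x *: w)) rpredD ?rpredZ //.
  exact: boundaries_cycles.
split=> [v /middleP[vZ /boundariesP[w hw vw]]|z zZ|v z vM zZ vz].
- have [h0 h1 dv] := cyclesT vZ; have /cyclesP[hv dv0] := vZ.
  set z := part false v - ((-1) ^+ n.+1 * x) *: w.
  have bnd : v - glue z 0 \in boundaries T n.+1.
    apply/boundariesP; exists (glue 0 w); first exact: homog_glue (@homog0 _ _ _) hw.
    rewrite (diff_glue (@homog0 _ _ _) hw) linear0 add0r -vw.
    apply: chainsT_eq; rewrite ?part0_glue ?part1_glue; apply/ffunP => b; rewrite !ffunE /=.
      by rewrite opprB addrC subrK.
    by rewrite subr0.
  exists z => //; apply/cyclesP; split.
    rewrite /z -scaleNr addrC; exact: homog_closed.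
  rewrite /z linearB linearZ /= -vw dv exprS mulN1r mulNr !scaleNr opprK addNr //.
- exists (glue z 0); last by rewrite subrr rpred0.
  apply/middleP; split; first exact: glue0_cycle.
  by rewrite part1_glue rpred0.
have -> : (v \in boundaries T n.+1) = (glue z 0 \in boundaries T n.+1).
  by apply/idP/idP => h; [exact: rpredBr_sub vz h | exact: rpredBl_sub vz h].
apply/boundariesP/addmulP => [[w hw zw]|[w /cyclesP[hw dw] /boundariesP[w0 hw0 zw]]].
  have h1 : homog n.+1 (part true w) by apply: homog_part; rewrite addn1.
  exists ((-1) ^+ n.+1 *: part true w).
    apply/cyclesP; split; first exact: homogZ.
    by rewrite linearZ /= -part1_diff -zw part1_glue scaler0.
  apply/boundariesP; exists (part false w); first by apply: homog_part; rewrite addn0.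
  by rewrite -signK -{1}(part0_glue z 0) zw (part0_diff hw) addrK.
have hw' : homog n.+1 ((-1) ^+ n.+1 *: w) by exact: homogZ.
exists (glue w0 ((-1) ^+ n.+1 *: w)); first exact: homog_glue.
rewrite (diff_glue hw0 hw') -sign_scale -zw subrK linearZ /= dw scaler0.
by [].
Qed.

(** The cokernel of [x] on [H_(n+1)(C)] is replaced by its kernel, of the same length,
    so that consecutive degrees telescope. *)
Lemma len_tensor_koszul1 :
  fin_len (boundaries C n.+1) (cycles C n.+1) -> fin_len (boundaries C n) (killed C x n) ->
  fin_len (boundaries T n.+1) (cycles T n.+1) /\
  len (boundaries T n.+1) (cycles T n.+1) =
    (len (boundaries C n.+1) (killed C x n.+1) + len (boundaries C n) (killed C x n))%N.
Proof.
move=> fZ fK; have [fu lu] := len_upper; have [fl ll] := len_lower.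
have MZ : {subset middle <= cycles T n.+1} by move=> v /middleP[].
have BM : {subset boundaries T n.+1 <= middle}.
  move=> v vB; apply/middleP; split; first exact: boundaries_cycles.
  case/boundariesP: vB => w hw ->; rewrite part1_diff; apply/boundariesP.
  by exists (part true w) => //; apply: homog_part; rewrite addn1.
have fM : fin_len (boundaries T n.+1) middle.
  apply/fl; apply: fin_len_sub fZ => // v vB.
  by apply/addmulP; exists 0; rewrite ?rpred0 // scaler0 subr0.
have fT : fin_len (boundaries T n.+1) (cycles T n.+1).
  by apply: (fin_len_trans BM MZ) => //; apply/fu.
split=> //; rewrite (len_add BM MZ fT) lu ll len_mul_coker //.
exact: boundaries_cycles.
Qed.

End Middle.
End TensorKoszul.

Section Koszul.
Variable R : comNzRingType.
Implicit Types (xs : seq R) (x : R).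

Lemma koszul_rcons xs x : koszul (rcons xs x) = tensor (koszul xs) (koszul1 x).
Proof. exact: foldl_rcons. Qed.

Lemma koszul_deg_le xs (b : koszul xs) : (deg b <= size xs)%N.
Proof.
elim/last_ind: xs b => [|xs x IH] //; rewrite koszul_rcons => -[b i].
by rewrite size_rcons /= /tensor_deg /= -addn1 leq_add //; case: i.
Qed.

Definition deg0_spec xs (C : free_complex R) (b0 : C) :=
  [/\ deg b0 = 0%N, forall b : C, deg b = 0%N -> b = b0 &
    forall v : chains C, homog 0 v -> (v \in boundaries C 0) = (v b0 \ini gen xs)].

(** Identifies [H_0] with the quotient of [R] by the ideal, through the coefficient
    of the only basis vector of degree [0]. *)
Lemma koszul_deg0 xs : exists b0, @deg0_spec xs (koszul xs) b0.
Proof.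
elim/last_ind: xs => [|xs x [b0 [d0 b0_uniq bnd]]].
  exists tt; split=> // [[] //|v hv]; rewrite gen_nil.
  apply/boundariesP/sub0P => [[w hw ->]|v0].
    by rewrite ffunE big1 // => a _; rewrite mulr0.
  exists 0; first exact: homog0.
  by rewrite linear0; apply/ffunP => -[]; rewrite ffunE.
rewrite koszul_rcons; set C := koszul xs in b0 d0 b0_uniq bnd *.
exists (b0, false); split=> [|[b i]|v hv]; first by rewrite /= /tensor_deg /= d0.
  by rewrite /= /tensor_deg /= => /eqP; rewrite addn_eq0; case: i => //= /andP[/eqP/b0_uniq ->].
rewrite gen_rcons; apply/boundariesP/ideal_adjP => [[w hw ->]|[a va]].
  have h0 : homog 1 (part false w) by apply: homog_part; rewrite addn0.
  exists (part true w b0); rewrite -partE (part0_diff hw) expr0 mul1r.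
  have addK (u p : chains C) : (u + x *: p) b0 - p b0 * x = u b0.
    by rewrite !ffunE [_ *: _]mulrC addrK.
  rewrite addK -bnd; last exact: homog_diff.
  by apply/boundariesP; exists (part false w).
pose c : chains C := [ffun b => if b == b0 then a else 0].
have hc : homog 0 c by move=> b nb; rewrite ffunE; case: (eqVneq b b0) nb => [->|] //; rewrite d0.
have hv0 : homog 0 (part false v) by apply: homog_part; rewrite addn0.
have hu : homog 0 (part false v - x *: c).
  by rewrite -scaleNr addrC; apply: homog_closed.
have /boundariesP[w hw vw] : part false v - x *: c \in boundaries C 0.
  rewrite bnd // !ffunE eqxx.
  by move: va; rewrite mulrC.
exists (glue x w c); first exact: homog_glue.
rewrite (diff_glue x hw hc) -vw expr0 mul1r subrK diff_homog0 //.
rewrite [LHS]chainsT_glue; congr (glue x _ _); apply/ffunP => b.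
by rewrite !ffunE hv //= /tensor_deg /= addn1.
Qed.

Lemma sum_telescope (k : nat -> nat) n :
  \sum_(i < n) (-1) ^+ i.+1 * (k i.+1 + k i)%N%:Z = (-1) ^+ n * (k n)%:Z - (k 0%N)%:Z.
Proof.
elim: n => [|n IH]; first by rewrite big_ord0 expr0 mul1r subrr.
by rewrite big_ord_recr /= IH exprS PoszD; ring.
Qed.

Lemma killed_fin (C : free_complex R) x n :
  fin_len (boundaries C n) (cycles C n) -> fin_len (boundaries C n) (killed C x n).
Proof. by apply: fin_len_sub => // v /subIP[]. Qed.

Lemma len_killed0 xs x :
  (fin_len (boundaries (koszul xs) 0) (killed (koszul xs) x 0) <->
    fin_len (gen xs) (colon (gen xs) x)) /\
  len (boundaries (koszul xs) 0) (killed (koszul xs) x 0) = len (gen xs) (colon (gen xs) x).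
Proof.
have [b0 [d0 b0_uniq bnd]] := koszul_deg0 xs.
apply: (len_matches (rho := fun (v : chains (koszul xs)) (r : R^o) => v b0 = r)).
- split=> [|a u v _ _ <- <-]; first by rewrite ffunE.
  by rewrite !ffunE.
- move=> v vB; apply/subIP; split; first exact: boundaries_cycles.
  by apply/scolonP; rewrite rpredZ.
- by move=> r; exact: sub_colon.
split=> [v /subIP[/cyclesP[hv _] /scolonP xv]|r rI|v r /subIP[/cyclesP[hv _] _] _ <-].
- exists (v b0) => //; rewrite mem_colon mulrC.
  by move: xv; rewrite bnd ?ffunE //; exact: homogZ.
- pose v : chains (koszul xs) := [ffun b => if b == b0 then r else 0].
  have hv : homog 0 v.
    by move=> b nb; rewrite ffunE; case: (eqVneq b b0) nb => [->|] //; rewrite d0.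
  exists v; last by rewrite ffunE eqxx.
  apply/subIP; split; first by apply/cyclesP; split=> //; exact: diff_homog0.
  apply/scolonP; rewrite bnd; last exact: homogZ.
  by rewrite !ffunE eqxx; rewrite mem_colon mulrC in rI.
exact: bnd.
Qed.

(** Each new element contributes, beyond pieces of the previous homology in positive
    degrees, only its kernel on [H_0], which is a colon quotient. *)
Lemma koszul_fin_len xs :
  (forall i, (i < size xs)%N -> fin_len (gen (take i xs)) (colon (gen (take i xs)) xs`_i)) ->
  forall n, fin_len (boundaries (koszul xs) n.+1) (cycles (koszul xs) n.+1).
Proof.
elim/last_ind: xs => [|xs x IH] hf n.
  have -> : cycles (koszul ([::] : seq R)) n.+1 = boundaries (koszul [::]) n.+1; last exact: fin_len_refl.
  apply: submod_anti; last exact: boundaries_cycles.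
  move=> v /cyclesP[hv _]; have -> : v = 0 by apply/ffunP => -[]; rewrite hv ?ffunE.
  exact: rpred0.
have {IH} IH k : fin_len (boundaries (koszul xs) k.+1) (cycles (koszul xs) k.+1).
  apply: IH => i lti; have := hf i; rewrite size_rcons nth_rcons lti -cats1 takel_cat ?(ltnW lti) //.
  by apply; exact: ltnW.
rewrite koszul_rcons; apply: (proj1 (len_tensor_koszul1 _ _)) => //.
case: n => [|n]; last exact: killed_fin.
apply/(proj1 (len_killed0 xs x)); have := hf (size xs); rewrite size_rcons ltnSn nth_rcons ltnn eqxx.
by rewrite -cats1 take_size_cat //; exact.
Qed.

(** The contributions of [H_n(K(xs))] to [H_n] and [H_(n+1)] of the larger complex
    are the cokernel and the kernel of [x], which have the same length when [n] is
    positive; hence only the kernel on [H_0] survives in the alternating sum. *)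
Lemma koszul_euler xs x :
  (forall i, (i <= size xs)%N ->
    fin_len (gen (take i (rcons xs x))) (colon (gen (take i (rcons xs x))) (rcons xs x)`_i)) ->
  \sum_(1 <= i < (size xs).+2)
      (-1) ^+ i * (module_length (homology (koszul (rcons xs x)) i))%:Z =
  - (len (gen xs) (colon (gen xs) x))%:Z.
Proof.
move=> hf; have f1 n : fin_len (boundaries (koszul xs) n.+1) (cycles (koszul xs) n.+1).
  apply: koszul_fin_len => i lti; have := hf i (ltnW lti).
  by rewrite nth_rcons lti -cats1 takel_cat ?(ltnW lti).
have f0 : fin_len (boundaries (koszul xs) 0) (killed (koszul xs) x 0).
  apply/(proj1 (len_killed0 xs x)); have := hf (size xs) (leqnn _).
  by rewrite nth_rcons ltnn eqxx -cats1 take_size_cat.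
pose k n := len (boundaries (koszul xs) n) (killed (koszul xs) x n).
have lenT n : module_length (homology (koszul (rcons xs x)) n.+1) = (k n.+1 + k n)%N.
  rewrite (proj2 (homology_len _ _)) koszul_rcons.
  apply: (proj2 (len_tensor_koszul1 _ _)) => //.
  by case: n => // n; exact: killed_fin.
have top : k (size xs).+1 = 0%N.
  rewrite /k; have -> : killed (koszul xs) x (size xs).+1 = boundaries (koszul xs) (size xs).+1.
    apply: submod_anti => v; last first.
      move=> vB; apply/subIP; split; first exact: boundaries_cycles.
      by apply/scolonP; rewrite rpredZ.
    move=> /subIP[/cyclesP[hv _] _]; have -> : v = 0; last exact: rpred0.
    by apply/ffunP => b; rewrite hv ?ffunE // neq_ltn ltnS koszul_deg_le.
  exact: len_refl.
rewrite big_add1 big_mkord /=; under eq_bigr => i _ do rewrite lenT.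
by rewrite sum_telescope top mulr0 sub0r /k (proj2 (len_killed0 xs x)).
Qed.

End Koszul.

Theorem theorem1 (R : comNzRingType) (m : ideal R)
  (hnoeth : noetherian R) (hloc : local_ring m)
  (s : nat) (x : s.-tuple R) (hx : filter_regular m x)
  (a : nat -> nat)
  (ha : forall i, a i = loewy_length (colon_quot x i) m)
  (N : nat)
  (hN : N = (maxn (\sum_(i < s) 2 ^ i * a i)
                  (\max_(i < s) artin_rees m (ideal_gen (mem (take i.+1 x)))))%N.+1)
  (eps : s.-tuple R)
  (heps : forall i : 'I_s, (tnth eps i : R^o) \in idealX m N)
  (x' : s.-tuple R)
  (hx' : forall i : 'I_s, tnth x' i = tnth x i + tnth eps i) :
  [/\ forall i, (1 <= i <= s)%N -> finite_length (homology (koszul x) i),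
      forall i, (1 <= i <= s)%N -> finite_length (homology (koszul x') i) &
      \sum_(1 <= i < s.+1) (-1) ^+ i * (module_length (homology (koszul x') i))%:Z
      = \sum_(1 <= i < s.+1) (-1) ^+ i * (module_length (homology (koszul x) i))%:Z].
Proof.
have kx : seq_kills m (sub0 R^o) x a.
  by move=> i lti; rewrite ha; exact: filter_regular_kills hx i lti.
have [kx' len_x'] : seq_kills m (sub0 R^o) x' (fun i => 2 ^ i * a i)%N /\
    forall i, (i < size x)%N ->
    len (adjs (sub0 R^o) (take i x')) (colon (adjs (sub0 R^o) (take i x')) x'`_i) =
    len (adjs (sub0 R^o) (take i x)) (colon (adjs (sub0 R^o) (take i x)) x`_i).
  apply: (perturb_colons hnoeth hloc (N := N) _ _ kx); rewrite ?size_tuple //.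
  - move=> i lti; have := hx' (Ordinal lti); have := heps (Ordinal lti).
    by rewrite !(tnth_nth 0) /= => eX ->; rewrite addrC addKr.
  - move=> i lti; rewrite adjs0; apply: (artin_rees_lt hnoeth).
    rewrite hN ltnS (leq_trans _ (leq_maxr _ _)) //.
    exact: (leq_bigmax (F := fun i : 'I_s => artin_rees m (ideal_gen (mem (take i.+1 x))))
      (Ordinal lti)).
  by rewrite hN ltnS leq_maxl.
have fin (y : s.-tuple R) e : seq_kills m (sub0 R^o) y e -> forall i, (i < s)%N ->
    fin_len (gen (take i y)) (colon (gen (take i y)) y`_i).
  move=> ky i lti; rewrite -adjs0; apply: (fin_len_kills hnoeth hloc) (ky i _).
    by move=> r; exact: sub_colon.
  by rewrite size_tuple.
have finH (y : s.-tuple R) e : seq_kills m (sub0 R^o) y e -> forall i, (1 <= i <= s)%N ->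
    finite_length (homology (koszul y) i).
  move=> ky [|i] // _; apply/(proj1 (homology_len _ _)); apply: koszul_fin_len.
  by rewrite size_tuple; exact: fin ky.
split; [exact: finH kx | exact: finH kx' |].
case: s => [|s] in x hx a ha hN eps heps x' hx' kx kx' len_x' fin finH *.
  by rewrite !big_geq.
have euler (y : s.+1.-tuple R) e : seq_kills m (sub0 R^o) y e ->
    \sum_(1 <= i < s.+2) (-1) ^+ i * (module_length (homology (koszul y) i))%:Z =
    - (len (adjs (sub0 R^o) (take s y)) (colon (adjs (sub0 R^o) (take s y)) y`_s))%:Z.
  move=> /fin; rewrite adjs0; case: y => /= y; case/lastP: y => // ys y.
  rewrite size_rcons eqSS => /eqP sz fy.
  have := @koszul_euler R ys y; rewrite sz => ->; last by move=> i lei; exact: fy.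
  by rewrite -sz -cats1 take_size_cat // nth_cat ltnn subnn.
by rewrite (euler x' _ kx') (euler x _ kx) len_x' // size_tuple.
Qed.
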